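(* Consider the variational inequality VI$(S,F)$ and the iterates $v_k=(v_{k,1},\dots,v_{k,J})$, $x_k=(x_{k,1},\dots,x_{k,J})$ of the modified Korpelevich method described in the context. Assume: (a) for every $j\in\{1,\dots,J\}$, $Y_j\subseteq\mathbb{R}^{n_j}$ is closed and convex, $S_j=X_j\cap Y_j$ is nonempty, and $g_{a}:\mathbb{R}^{n_j}\to\mathbb{R}$ is convex for every $a\in\mathscr{A}_j$; (b) there is $M_g>0$ with $\|d\|\le M_g$ for all $d\in\partial g_{a}(x_j)$, $x_j\in Y_j$, $a\in\mathscr{A}_j$, $j=1,\dots,J$; (c) $\|F(x)-F(y)\|\le L\|x-y\|$ for all $x,y\in Y$, with $L>0$; (d) $\langle F(x)-F(y),x-y\rangle\ge\mu\|x-y\|^2$ for all $x,y\in Y$, with $\mu>0$; (e) there is $c>0$ such that for all $j\in\{1,\dots,J\}$ (and every iteration $k\ge1$), $\mathrm{dist}^2(x_j,S_j)\le c\,\mathbb{E}\big[(g^+_{\omega_{k,j}^i}(x_j))^2\big]$ for all $x_j\in Y_j$ and $i=1,\dots,N_{k,j}$; (f) the step sizes satisfy $\alpha_k>0$, $\sum_{k=0}^\infty\alpha_k=\infty$, $\sum_{k=0}^\infty\alpha_k^2<\infty$, and $\alpha_k\le\frac{1}{4(L+\mu)}$ for all $k$; (g) the scalar $\zeta_k$ of the analysis is $\zeta_k=\frac{q}{1-q}(1-\alpha_k\mu)$, where $q=\frac{\beta(2-\beta)}{cM_g^2}$. Let $x^*\in S$ be the (unique) solution of VI$(S,F)$.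 Then, for any choice of the batch sizes $N_{k,j}\ge1$ for all $k$ and $j$: (i) the iterates $v_k,x_k\in Y$ converge to $x^*$ almost surely and in expectation; (ii) the distance $\mathrm{dist}(x_k,S)$ converges to $0$ almost surely and in expectation.
   Context: Setting. $J\ge1$ agents; for each $j\in\{1,\dots,J\}$: a set $Y_j\subseteq\mathbb{R}^{n_j}$, a (possibly infinite) index set $\mathscr{A}_j$, functions $g_a:\mathbb{R}^{n_j}\to\mathbb{R}$ ($a\in\mathscr{A}_j$), $X_j=\bigcap_{a\in\mathscr{A}_j}\{x_j\in\mathbb{R}^{n_j}: g_a(x_j)\le0\}$, $S_j=X_j\cap Y_j$. Put $n=\sum_j n_j$, $Y=\prod_jY_j$, $S=\prod_jS_j$. The mapping $F:Y\to\mathbb{R}^n$ has blocks $[F(x)]_j\in\mathbb{R}^{n_j}$ (in the underlying game, $[F(x)]_j$ is the gradient of agent $j$'s cost in its own variable). VI$(S,F)$: find $x^*\in S$ with $\langle F(x^* ),x-x^*\rangle\ge0$ for all $x\in S$. Notation: $\|\cdot\|$ is the Euclidean norm, $g^+(x)=\max\{g(x),0\}$, $\partial$ is the convex subdifferential, $\Pi_C$ is Euclidean projection onto a closed convex set $C$, $\mathrm{dist}(x,C)=\min_{y\in C}\|x-y\|$. Random feasibility steps (agent $j$, iteration $k\ge1$). Input: $v_{k,j}\in Y_j$, deterministic batch size $N_{k,j}\ge1$ (integer), deterministic $\beta\in(0,2)$. Set $z_{k,j}^0=v_{k,j}$. For $i=1,\dots,N_{k,j}$: draw a random index $\omega_{k,j}^i\in\mathscr{A}_j$;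 if $g^+_{\omega_{k,j}^i}(z_{k,j}^{i-1})>0$ take $d_{k,j}^i\in\partial g^+_{\omega_{k,j}^i}(z_{k,j}^{i-1})$, otherwise take $d_{k,j}^i=d$ for some fixed $d\neq0$; set $$z_{k,j}^i=\Pi_{Y_j}\Big[z_{k,j}^{i-1}-\beta\,\tfrac{g^+_{\omega_{k,j}^i}(z_{k,j}^{i-1})}{\|d_{k,j}^i\|^2}d_{k,j}^i\Big].$$ Output: $x_{k,j}=z_{k,j}^{N_{k,j}}$. Regarding the sampling of the indices, assumption (e) is said to allow independent identically distributed sampling as well as sampling with distribution conditional on the past samples drawn at iteration $k$. Modified Korpelevich method. Start from random $x_{0,j}\in Y_j$ with $\mathbb{E}\|x_{0,j}\|^2<\infty$. For $k\ge1$ and each $j$: $u_{k,j}=\Pi_{Y_j}[x_{k-1,j}-\alpha_{k-1}[F(x_{k-1})]_j]$; with $u_k=(u_{k,1},\dots,u_{k,J})$, $v_{k,j}=\Pi_{Y_j}[x_{k-1,j}-\alpha_{k-1}[F(u_k)]_j]$; then $x_{k,j}$ is the output of the random feasibility steps with input $v_{k,j}$, $N_{k,j}$. The scalar $\zeta_k$ is only an artifact of the convergence analysis and is not a parameter of the method. The quantity $q$ lies in $(0,1]$ and is taken to be $<1$ without loss of generality. ''Converge in expectation'' means $\mathbb{E}\|v_k-x^*\|\to0$, $\mathbb{E}\|x_k-x^*\|\to0$, $\mathbb{E}[\mathrm{dist}(x_k,S)]\to0$.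
   Formalization: In (e) the expectation is conditional on the history of iterations before k (x_0, samples, directions), which equals the plain one if iteration k's samples are independent of that history; with only the plain one the claim fails, e.g. if one random index is reused forever. *)

(* Defs.v *)
From HB Require Import structures.
From mathcomp Require Import all_boot all_order all_algebra.
From mathcomp Require Import all_classical all_reals all_analysis.
From mathcomp Require Import measurable_realfun.

Set Implicit Arguments.
Unset Strict Implicit.
Unset Printing Implicit Defensive.

Import Order.TTheory GRing.Theory Num.Theory.
Import numFieldNormedType.Exports.

Local Open Scope classical_set_scope.
Local Open Scope ring_scope.

(* The library norm on 'rV[R]_m is the sup norm, hence [enorm]; both norms
   induce the library topology on 'rV[R]_m. *)
Section euclidean.
Context {R : realType} {m : nat}.
Implicit Types (x y d : 'rV[R]_m) (C : set 'rV[R]_m) (f : 'rV[R]_m -> R).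

Definition dot x y : R := \sum_(i < m) x 0 i * y 0 i.

Definition enorm x : R := Num.sqrt (dot x x).

(* A minimum, attained, when C is closed and nonempty. *)
Definition dist x C : R := inf [set enorm (x - y) | y in C].

(* [xget 0] picks the nearest point, which exists and is unique when C is
   closed, convex and nonempty. *)
Definition proj C x : 'rV[R]_m :=
  xget 0 [set p | C p /\ forall y, C y -> enorm (x - p) <= enorm (x - y)].

Definition pos_part f x : R := Num.max (f x) 0.

Definition subdifferential f x : set 'rV[R]_m :=
  [set d | forall y, f x + dot d (y - x) <= f y].

Definition VI_solution (S : set 'rV[R]_m) (F : 'rV[R]_m -> 'rV[R]_m)
    (xs : 'rV[R]_m) : Prop :=
  S xs /\ forall x, S x -> 0 <= dot (F xs) (x - xs).

End euclidean.

Section probability.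
Context {R : realType} {dO : measure_display} {Omega : measurableType dO}.

Definition random_vector {m : nat} (X : Omega -> 'rV[R]_m) : Prop :=
  forall i, measurable_fun [set: Omega] (fun w => X w 0 i).

(* [h] is a version of E[X | G], for a nonnegative X and a sigma-algebra G. *)
Definition is_cond_exp (P : probability Omega R) (G : set (set Omega))
    (X h : Omega -> \bar R) : Prop :=
  [/\ forall w, (0 <= h w)%E,
      forall B : set (\bar R), measurable B -> G (h @^-1` B)
    & forall A, G A -> (\int[P]_(w in A) h w = \int[P]_(w in A) X w)%E].

End probability.

(* Vectors of R^(n_1 + ... + n_J) are block rows; the j-th block of x is
   [submxrow x j]. *)
Section game.
Context {R : realType} {J : nat} {n : 'I_J -> nat}.

Definition block_prod (C : forall j, set 'rV[R]_(n j)) :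
    set 'rV[R]_(\sum_j n j) :=
  [set x | forall j, C j (submxrow x j)].

Definition level_set {A : 'I_J -> Type} (g : forall j, A j -> 'rV[R]_(n j) -> R)
    (j : 'I_J) : set 'rV[R]_(n j) :=
  \bigcap_(a in [set: A j]) [set x | g j a x <= 0].
Arguments level_set {A} g j.

Definition feasible_set {A : 'I_J -> Type}
    (g : forall j, A j -> 'rV[R]_(n j) -> R)
    (Y : forall j, set 'rV[R]_(n j)) (j : 'I_J) : set 'rV[R]_(n j) :=
  level_set g j `&` Y j.
Arguments feasible_set {A} g Y j.

Context {dO : measure_display} {Omega : measurableType dO}
  {dA : 'I_J -> measure_display} {A : forall j, measurableType (dA j)}.

(* The data of a run: x k for k >= 0; u k and v k for k >= 1; z k j i for
   k >= 1 and 0 <= i <= N k j; samples omega k j i and directions d k j i for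
   k >= 1 and 1 <= i <= N k j. Other index values are irrelevant. F is only
   evaluated at points of the product of the Y j. *)
Record korpelevich_run (Y : forall j, set 'rV[R]_(n j))
    (g : forall j, A j -> 'rV[R]_(n j) -> R)
    (F : 'rV[R]_(\sum_j n j) -> 'rV[R]_(\sum_j n j))
    (alpha : nat -> R) (beta : R) (N : nat -> 'I_J -> nat)
    (d0 : forall j, 'rV[R]_(n j))
    (omega : nat -> forall j, nat -> Omega -> A j)
    (d z : nat -> forall j, nat -> Omega -> 'rV[R]_(n j))
    (x u v : nat -> Omega -> 'rV[R]_(\sum_j n j)) : Prop := KorpelevichRun {
  run_init : forall w, block_prod Y (x 0%N w) ;
  run_u : forall k w j,
    submxrow (u k.+1 w) j =
    proj (Y j) (submxrow (x k w) j - alpha k *: submxrow (F (x k w)) j) ;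
  run_v : forall k w j,
    submxrow (v k.+1 w) j =
    proj (Y j) (submxrow (x k w) j - alpha k *: submxrow (F (u k.+1 w)) j) ;
  run_z0 : forall k w j, z k.+1 j 0%N w = submxrow (v k.+1 w) j ;
  run_d : forall k w j i, (i < N k.+1 j)%N ->
    let gp := pos_part (g j (omega k.+1 j i.+1 w)) in
    let z' := z k.+1 j i w in
    if 0 < gp z' then subdifferential gp z' (d k.+1 j i.+1 w)
    else d k.+1 j i.+1 w = d0 j ;
  run_z : forall k w j i, (i < N k.+1 j)%N ->
    let gp := pos_part (g j (omega k.+1 j i.+1 w)) in
    let z' := z k.+1 j i w in
    let d' := d k.+1 j i.+1 w in
    z k.+1 j i.+1 w = proj (Y j) (z' - (beta * (gp z' / enorm d' ^+ 2)) *: d') ;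
  run_x : forall k w j, submxrow (x k.+1 w) j = z k.+1 j (N k.+1 j) w
}.

(* The sigma-algebra of the history of the method up to the end of iteration
   k: generated by the starting point and by the samples drawn and the
   subgradients chosen in iterations 1, ..., k. *)
Definition history (N : nat -> 'I_J -> nat)
    (omega : nat -> forall j, nat -> Omega -> A j)
    (d : nat -> forall j, nat -> Omega -> 'rV[R]_(n j))
    (x0 : Omega -> 'rV[R]_(\sum_j n j)) (k : nat) : set (set Omega) :=
  <<s [set E | exists i (B : set R),
         measurable B /\ E = (fun w => x0 w 0 i) @^-1` B] `|`
      [set E | exists l j i (B : set (A j)),
         [/\ (1 <= l <= k)%N, (1 <= i <= N l j)%N, measurable B &
             E = omega l j i @^-1` B]] `|`
      [set E | exists l j i t (B : set R),
         [/\ (1 <= l <= k)%N, (1 <= i <= N l j)%N, measurable B &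
             E = (fun w => d l j i w 0 t) @^-1` B]] >>.

(* There is no independence assumption: the expectation bounding the squared
   distance is conditional on the history before iteration k. It is the plain
   expectation when the samples of iteration k are independent of that history,
   and by the tower property the bound follows from the one obtained by
   conditioning also on samples drawn earlier in iteration k. *)
Definition sampling_regularity (P : probability Omega R)
    (Y : forall j, set 'rV[R]_(n j))
    (g : forall j, A j -> 'rV[R]_(n j) -> R)
    (N : nat -> 'I_J -> nat)
    (omega : nat -> forall j, nat -> Omega -> A j)
    (d : nat -> forall j, nat -> Omega -> 'rV[R]_(n j))
    (x0 : Omega -> 'rV[R]_(\sum_j n j)) (c : R) : Prop :=
  forall k j i (y : 'rV[R]_(n j)), (1 <= i <= N k.+1 j)%N -> Y j y ->
    exists2 h : Omega -> \bar R,
      is_cond_exp P (history N omega d x0 k)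
        (fun w => (pos_part (g j (omega k.+1 j i w)) y ^+ 2)%:E) h
      & {ae P, forall w, ((dist y (feasible_set g Y j) ^+ 2)%:E <= c%:E * h w)%E}.

End game.

Arguments level_set {R J n A} g j.
Arguments feasible_set {R J n A} g Y j.

(* Main.v *)
Require Import Defs.
From HB Require Import structures.
From mathcomp Require Import all_boot all_order all_algebra.
From mathcomp Require Import all_classical all_reals all_analysis.
From mathcomp Require Import measurable_realfun.
From mathcomp Require Import ring lra.

Set Implicit Arguments.
Unset Strict Implicit.
Unset Printing Implicit Defensive.

Import Order.TTheory GRing.Theory Num.Theory.
Import numFieldNormedType.Exports.

Local Open Scope classical_set_scope.
Local Open Scope ring_scope.

(** Let [V k] be the squared distance from [x k] to the solution [xs]. The theorem
    holds because [V] is, up to a summable perturbation, a nonnegative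
    supermartingale for the history of the method, whose mean contracts by the
    factor [1 - alpha k * mu] at each iteration:
    [E (V k.+1 | history k) <= (1 - alpha k * mu) * V k + C * alpha k ^+ 2].

    The extragradient part of an iteration contributes the factor, thanks to strong
    monotonicity ([korpelevich_descent]). As it projects on the product of the sets
    [Y j] while [xs] solves the inequality on the smaller feasible set, it leaves an
    error of order [alpha k] times the distances from the blocks of [v] to the
    feasible sets. Young's inequality turns this error into a term of order
    [alpha k ^+ 2] and a small multiple of the squared distances
    ([korpelevich_step_dist]).

    The feasibility steps pay for these squared distances. Each step is a Polyak
    step, which decreases the squared distance to every feasible point in
    proportion to the squared violation of the sampled constraint
    ([feasibility_step]). By the sampling condition the mean violation at a fixed
    point dominates the squared distance to the feasible set. The method needs this
    at the random point [v], which the history determines; it follows by splitting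
    into countably many cells ([freezing]), because the violations are uniformly
    Lipschitz ([pos_part_lipschitz]). That in turn uses the existence of subgradients
    of convex functions ([subdifferential_nonempty]), a finite-dimensional
    Hahn-Banach theorem.

    The divergence of the series of steps drives the mean of [V] to 0
    ([stochastic_recursion_cvg0]). Almost sure convergence follows without a general
    martingale convergence theorem: a nonnegative supermartingale whose mean tends to
    0 tends to 0 almost surely, by the maximal inequality applied from later and
    later times ([recursion_cvg_ae]). The point [v k.+1] and the distance from [x k]
    to the feasible set are controlled by [V k] and the step. *)

Local Notation proj := Defs.proj.

(** * Euclidean geometry of row vectors *)

Section euclidean_space.
Context {R : realType} {m : nat}.
Implicit Types (x y z e : 'rV[R]_m) (C : set 'rV[R]_m) (t : R).

Lemma dotC x y : dot x y = dot y x.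
Proof. by apply: eq_bigr => i _; rewrite mulrC. Qed.

Lemma dotDl x y z : dot (x + y) z = dot x z + dot y z.
Proof. by rewrite -big_split; apply: eq_bigr => i _; rewrite mxE mulrDl. Qed.

Lemma dotZl t x y : dot (t *: x) y = t * dot x y.
Proof. by rewrite mulr_sumr; apply: eq_bigr => i _; rewrite mxE mulrA. Qed.

Lemma dotNl x y : dot (- x) y = - dot x y.
Proof. by rewrite -scaleN1r dotZl mulN1r. Qed.

Lemma dotDr x y z : dot z (x + y) = dot z x + dot z y.
Proof. by rewrite dotC dotDl !(dotC z). Qed.

Lemma dotZr t x y : dot x (t *: y) = t * dot x y.
Proof. by rewrite dotC dotZl dotC. Qed.

Lemma dotNr x y : dot x (- y) = - dot x y.
Proof. by rewrite dotC dotNl dotC. Qed.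

Definition dotE := (dotDl, dotDr, dotNl, dotNr, dotZl, dotZr).

Lemma dot_ge0 x : 0 <= dot x x.
Proof. by apply: sumr_ge0 => i _; rewrite -expr2 sqr_ge0. Qed.

Lemma enorm_ge0 x : 0 <= enorm x.
Proof. exact: sqrtr_ge0. Qed.

Lemma enorm_sqr x : enorm x ^+ 2 = dot x x.
Proof. by rewrite sqr_sqrtr// dot_ge0. Qed.

Lemma normr_coord_le_enorm x i : `|x 0 i| <= enorm x.
Proof.
rewrite -sqrtr_sqr ler_sqrt ?dot_ge0// /dot (bigD1 i)//= expr2 lerDl.
by apply: sumr_ge0 => j _; rewrite -expr2 sqr_ge0.
Qed.

Lemma norm_le_enorm x : `|x| <= enorm x.
Proof.
rewrite /Num.norm/= mx_normrE; apply/bigmax_leP; split=> [|[i j] _ /=].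
  exact: enorm_ge0.
by rewrite ord1; exact: normr_coord_le_enorm.
Qed.

Lemma enorm_eq0 x : enorm x = 0 -> x = 0.
Proof.
move=> x0; apply/rowP => i; rewrite mxE; apply/eqP; rewrite -normr_le0.
by have := normr_coord_le_enorm x i; rewrite x0.
Qed.

Lemma enorm_le_sum x : enorm x <= \sum_i `|x 0 i|.
Proof.
have s0 (P : pred 'I_m) : 0 <= \sum_(i | P i) `|x 0 i|.
  by apply: sumr_ge0 => i _.
rewrite -[leRHS]ger0_norm ?s0// -sqrtr_sqr ler_sqrt ?sqr_ge0// expr2 mulr_suml.
apply: ler_sum => i _; rewrite -expr2 -real_normK ?num_real// expr2.
by rewrite ler_wpM2l// (bigD1 i)//= lerDl.
Qed.

Lemma enormN x : enorm (- x) = enorm x.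
Proof. by rewrite /enorm dotNl dotNr opprK. Qed.

Lemma enorm_distC x y : enorm (x - y) = enorm (y - x).
Proof. by rewrite -enormN opprB. Qed.

Lemma dot_le_enorm x y : dot x y <= enorm x * enorm y.
Proof.
have [x0|x0] := eqVneq (enorm x) 0.
  by rewrite x0 mul0r (enorm_eq0 x0) -(scale0r 0) dotZl mul0r.
have [y0|y0] := eqVneq (enorm y) 0.
  by rewrite y0 mulr0 (enorm_eq0 y0) -(scale0r 0) dotZr mul0r.
have xy : 0 < enorm x * enorm y.
  by rewrite mulr_gt0// lt_neqAle eq_sym ?x0 ?y0/= enorm_ge0.
have := dot_ge0 (enorm y *: x - enorm x *: y).
rewrite !dotE (dotC y x) -!enorm_sqr.
by nra.
Qed.

Lemma normr_dot_le x y : `|dot x y| <= enorm x * enorm y.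
Proof.
rewrite ler_norml dot_le_enorm andbT lerNl -dotNl.
by apply: (le_trans (dot_le_enorm _ _)); rewrite enormN.
Qed.

Lemma enormD x y : enorm (x + y) <= enorm x + enorm y.
Proof.
rewrite -ler_sqr ?nnegrE ?addr_ge0 ?enorm_ge0// enorm_sqr !dotE (dotC y x).
have := dot_le_enorm x y; rewrite sqrrD -!enorm_sqr; lra.
Qed.

Lemma enorm_triangle x y z : enorm (x - z) <= enorm (x - y) + enorm (y - z).
Proof. by rewrite -[x - z](subrKA y) enormD. Qed.

Lemma enorm_lipschitz x y : `|enorm x - enorm y| <= enorm (x - y).
Proof.
have := enorm_triangle x y 0; have := enorm_triangle y x 0.
rewrite !subr0 (enorm_distC y x) => *.
by rewrite ler_norml; apply/andP; split; lra.
Qed.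

Lemma convex_set_combination C x y t : convex_set C -> C x -> C y ->
  0 <= t <= 1 -> C (t *: x + (1 - t) *: y).
Proof.
move=> cC Cx Cy t01; have t01' : Itv.spec (@Itv.num_sem R)
    (Itv.Real `[0%Z, 1%Z]) t by rewrite /Itv.num_sem/= num_real /= in_itv/=.
by have /set_mem := cC x y (Itv.mk t01') (mem_set Cx) (mem_set Cy).
Qed.

Lemma continuous_enorm_dist x : continuous (fun y => enorm (x - y)).
Proof.
have cdot : continuous (fun y => dot (x - y) (x - y)).
  apply: (@continuous_big _ _ _ _ _ _ _ _
    (fun i y => (x - y) 0 i * (x - y) 0 i)) => [|i _ y].
    exact: add_continuous.
  have h : (fun y => (x - y) 0 i) y @[y --> y] --> (x - y) 0 i.
    rewrite (_ : (fun _ => _) = (fun y => x 0 i - y 0 i)); last first.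
      by apply/funext => u; rewrite !mxE.
    rewrite !mxE.
    have c1 := @cvg_cst _ (x 0 i) _ (nbhs y) (nbhs_filter y).
    exact: cvgB c1 (@coord_continuous R 1 m 0 i y).
  exact: (cvgM h h).
by move=> y; exact: continuous_comp (cdot y) (@sqrt_continuous R _).
Qed.

End euclidean_space.

Lemma cvg0_of_sqr {R : realType} (f : nat -> R) : (forall k, 0 <= f k) ->
  f k ^+ 2 @[k --> \oo] --> (0 : R) -> f k @[k --> \oo] --> (0 : R).
Proof.
move=> f0 /cvgrPdist_le hf; apply/cvgrPdist_le => e e0.
apply: filterS (hf _ (exprn_gt0 2 e0)) => k.
rewrite !sub0r !normrN ger0_norm ?sqr_ge0// ger0_norm//.
by rewrite ler_sqr ?nnegrE// ltW.
Qed.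

Lemma cvg_enorm {R : realType} m (y : nat -> 'rV[R]_m) (l : 'rV[R]_m) :
  enorm (y k - l) @[k --> \oo] --> (0 : R) -> y k @[k --> \oo] --> l.
Proof.
move=> /cvgrPdist_le h; apply/cvgrPdist_le => e e0.
apply: filterS (h _ e0) => k; rewrite sub0r normrN ger0_norm ?enorm_ge0//.
by rewrite enorm_distC; exact: le_trans (norm_le_enorm _).
Qed.

(** * Projection and distance *)

Section projection.
Context {R : realType} {m : nat} (C : set 'rV[R]_m).
Hypotheses (closedC : closed C) (convexC : convex_set C) (C0 : C !=set0).
Implicit Types x y : 'rV[R]_m.

(** The points at most as far from [x] as a given point of [C] form a compact
    set, on which the distance to [x] attains its minimum. *)
Lemma proj_spec x :
  C (proj C x) /\ forall y, C y -> enorm (x - proj C x) <= enorm (x - y).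
Proof.
rewrite /proj; case: xgetP => [p _ //|noproj]; exfalso.
have [y0 Cy0] := C0.
pose K := C `&` [set y | enorm (x - y) <= enorm (x - y0)].
have Kc : compact K.
  apply: bounded_closed_compact.
    exists (enorm x + enorm (x - y0)); split; first exact: num_real.
    move=> M hM y [_ /= hy]; apply: (le_trans (norm_le_enorm y)).
    apply: ltW; apply: le_lt_trans hM.
    have := enorm_triangle y x 0; rewrite !subr0 (enorm_distC y x).
    by lra.
  apply: closedI => //.
  apply: (@preimage_closed _ _ _ [set r | r <= enorm (x - y0)]).
    move=> y _; exact: continuous_enorm_dist.
  exact: closed_le.
have [||p /set_mem[Cp xp] pmin] :=
  @EVT_min_rV R m (fun y => enorm (x - y)) K _ Kc.
- by exists y0; split => /=.
- apply: continuous_subspaceT => y; exact: continuous_enorm_dist.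
apply: (noproj p); split => // y Cy.
have [yy0|/ltW yy0] := leP (enorm (x - y)) (enorm (x - y0)).
  by apply: pmin; apply/mem_set; split.
exact: le_trans xp yy0.
Qed.

Lemma proj_in x : C (proj C x).
Proof. by have [] := proj_spec x. Qed.

(** Minimality of the projection along the segment towards [y]: moving by a
    fraction [t] changes the squared distance by [- 2 * t * a + t ^+ 2 * b],
    where [a] is the inner product and [b] the squared length of the segment;
    this is negative for small [t] when [a] is positive. *)
Lemma proj_variational x y : C y -> dot (x - proj C x) (y - proj C x) <= 0.
Proof.
move=> Cy; set p := proj C x; rewrite leNgt; apply/negP => a0.
set a := dot _ _ in a0; set b := dot (y - p) (y - p).
have b0 : 0 <= b by exact: dot_ge0.
(* small enough for [t * b < a], and at most 1 *)
pose t := a / (a + b + 1).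
have t0 : 0 < t by rewrite divr_gt0//; lra.
have tE : t * (a + b + 1) = a by rewrite /t mulfVK// gt_eqF//; lra.
have t1 : t <= 1 by nra.
have := (proj_spec x).2 (t *: y + (1 - t) *: p).
have -> : x - (t *: y + (1 - t) *: p) = x - p - t *: (y - p).
  by apply/rowP => i; rewrite !mxE; ring.
rewrite -/p -ler_sqr ?nnegrE ?enorm_ge0// !enorm_sqr.
have -> : dot (x - p - t *: (y - p)) (x - p - t *: (y - p)) =
   dot (x - p) (x - p) - 2 * t * a + t ^+ 2 * b.
  by rewrite /a /b !dotE !(dotC _ x) (dotC p y); ring.
have Ct : C (t *: y + (1 - t) *: p).
  by apply: convex_set_combination => //; [exact: proj_in|rewrite t1 ltW].
move=> /(_ Ct); nra.
Qed.

Lemma proj_nonexpansive x y : enorm (proj C x - proj C y) <= enorm (x - y).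
Proof.
have h1 := proj_variational x (proj_in y).
have h2 := proj_variational y (proj_in x).
set p := proj C x in h1 h2 *; set r := proj C y in h1 h2 *.
have h : dot (p - r) (p - r) <= dot (x - y) (p - r).
  have -> : dot (x - y) (p - r) =
    dot (p - r) (p - r) - dot (x - p) (r - p) - dot (y - r) (p - r).
    by rewrite !dotE ?(dotC _ x) ?(dotC r p) ?(dotC _ y); ring.
  by lra.
have := dot_le_enorm (x - y) (p - r).
have := enorm_ge0 (p - r); have := enorm_ge0 (x - y).
by move: h; rewrite -enorm_sqr; nra.
Qed.

(** In the triangle [x], [proj C x], [y] the angle at the projection is not
    acute, so that the side opposite to it is the longest one. *)
Lemma proj_contracts x y : C y -> enorm (proj C x - y) <= enorm (x - y).
Proof.
move=> Cy; have h := proj_variational x Cy; set p := proj C x in h *.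
have h' : dot (p - y) (p - y) <= dot (x - y) (p - y).
  have -> : dot (x - y) (p - y) = dot (p - y) (p - y) - dot (x - p) (y - p).
    by rewrite !dotE ?(dotC _ x) ?(dotC r p) ?(dotC _ y); ring.
  by lra.
have := dot_le_enorm (x - y) (p - y).
have := enorm_ge0 (p - y); have := enorm_ge0 (x - y).
by move: h'; rewrite -enorm_sqr; nra.
Qed.

End projection.

Section distance.
Context {R : realType} {m : nat} (S : set 'rV[R]_m).
Hypothesis S0 : S !=set0.
Implicit Types x y s : 'rV[R]_m.

Let dist_lb x : has_lbound [set enorm (x - y) | y in S].
Proof. by exists 0 => _ [y _ <-]; exact: enorm_ge0. Qed.

Lemma dist_ge0 x : 0 <= dist x S.
Proof.
apply: lb_le_inf => [|_ [y _ <-]]; last exact: enorm_ge0.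
by have [s Ss] := S0; exists (enorm (x - s)), s.
Qed.

Lemma dist_le x s : S s -> dist x S <= enorm (x - s).
Proof. by move=> Ss; apply: ge_inf => //; exists s. Qed.

Lemma dist_ge x r : (forall s, S s -> r <= enorm (x - s)) -> r <= dist x S.
Proof.
move=> h; apply: lb_le_inf => [|_ [y Sy <-]]; last exact: h.
by have [s Ss] := S0; exists (enorm (x - s)), s.
Qed.

Lemma dist_lipschitz x y : dist x S <= dist y S + enorm (x - y).
Proof.
rewrite -lerBlDr; apply: dist_ge => s Ss; rewrite lerBlDr addrC.
exact: le_trans (dist_le x Ss) (enorm_triangle _ _ _).
Qed.

Lemma dist_lip_norm x y : `|dist x S - dist y S| <= enorm (x - y).
Proof.
have := dist_lipschitz x y; have := dist_lipschitz y x.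
by rewrite (enorm_distC y x) ler_norml => *; apply/andP; split; lra.
Qed.

End distance.

(** * Convex functions and the feasibility step *)

Section convex_functions.
Context {R : realType} {m : nat}.
Implicit Types (f : 'rV[R]_m -> R) (x y h d : 'rV[R]_m) (t : R).

(** Convexity with a plain real number as coefficient, which suits arithmetic
    reasoning better than an element of the unit interval. *)
Definition jensen f := forall x y t, 0 <= t <= 1 ->
  f (t *: x + (1 - t) *: y) <= t * f x + (1 - t) * f y.

Lemma convex_function_jensen f :
  convex_function [set: 'rV[R]_m] f -> jensen f.
Proof.
move=> cf x y t t01; have t01' : Itv.spec (@Itv.num_sem R)
    (Itv.Real `[0%Z, 1%Z]) t by rewrite /Itv.num_sem/= num_real /= in_itv/=.
exact: cf (Itv.mk t01') _ _ (in_setT x) (in_setT y).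
Qed.

(** The finite-dimensional Hahn-Banach argument: a linear minorant on the vectors
    supported by the first [k] coordinates extends to one more coordinate [e].
    A slope [c] along [e] is admissible when it lies above the quotients of [lo]
    and below those of the opposite direction, and convexity separates the two
    families. *)
Lemma linear_minorant f : jensen f -> f 0 = 0 ->
  exists d, forall h, dot d h <= f h.
Proof.
move=> cf f0.
suff extend (k : nat) : exists d, forall h,
    (forall i : 'I_m, (k <= i)%N -> h 0 i = 0) -> dot d h <= f h.
  have [d hd] := extend m; exists d => h; apply: hd => i.
  by rewrite leqNgt ltn_ord.
elim: k => [|k [d hd]].
  exists 0 => h h0; have -> : h = 0 by apply/rowP => i; rewrite mxE h0.
  by rewrite -(scale0r 0) dotZl mul0r scale0r f0.
have [mk|km] := leqP m k.
  by exists d => h _; apply: hd => i; rewrite leqNgt (leq_trans (ltn_ord i) mk).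
pose ik := Ordinal km; pose e : 'rV[R]_m := delta_mx 0 ik.
pose supp h := forall i : 'I_m, (k <= i)%N -> h 0 i = 0.
pose lo := [set r | exists h t,
  [/\ supp h, 0 < t & r = (dot d h - f (h - t *: e)) / t]].
have up h s : supp h -> 0 < s -> ubound lo ((f (h + s *: e) - dot d h) / s).
  move=> hh s0 _ [h' [t [hh' t0 ->]]].
  rewrite ler_pdivrMr// mulrAC ler_pdivlMr//.
  (* with this weight the two multiples of [e] cancel *)
  pose w := t / (s + t).
  have st : s + t != 0 by rewrite gt_eqF// addr_gt0.
  have w01 : 0 <= w <= 1.
    rewrite divr_ge0 ?ler_pdivrMr ?mul1r ?addr_gt0 ?addr_ge0 ?(ltW s0) ?(ltW t0)//=.
    by rewrite lerDr ltW.
  have := cf (h + s *: e) (h' - t *: e) w w01.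
  have -> : w *: (h + s *: e) + (1 - w) *: (h' - t *: e) = w *: h + (1 - w) *: h'.
    apply/rowP => i; rewrite !mxE /w.
    by field.
  have hw : supp (w *: h + (1 - w) *: h').
    by move=> i ki; rewrite !mxE hh// hh'// !mulr0 addr0.
  move=> /(le_trans (hd _ hw)); rewrite !dotE.
  rewrite -(ler_pM2l (addr_gt0 s0 t0)).
  have wE : (s + t) * w = t by rewrite /w mulrC divfK.
  set a := dot d h; set b := dot d h'; set p := f (h + _); set r := f (h' - _).
  have wC a1 b1 : (s + t) * (w * a1 + (1 - w) * b1) = t * a1 + s * b1.
    transitivity ((s + t) * w * a1 + (s + t) * b1 - (s + t) * w * b1); first by ring.
    by rewrite wE; ring.
  by rewrite !wC; lra.
have s0 : supp 0 by move=> i _; rewrite mxE.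
have lo0 : lo !=set0 by exists ((dot d 0 - f (0 - 1 *: e)) / 1), 0, 1.
have loub : has_ubound lo by eexists; exact: (up 0 1).
pose c := sup lo.
exists (\row_i if i == ik then c else d 0 i) => h hh.
pose h0 : 'rV[R]_m := \row_i if i == ik then 0 else h 0 i.
have hE : h = h0 + h 0 ik *: e.
  apply/rowP => i; rewrite !mxE /=; case: eqP => [->|_]; rewrite ?mulr1 ?add0r//.
  by rewrite mulr0 addr0.
have h0s : supp h0.
  move=> i; rewrite mxE leq_eqVlt => /orP[/eqP ki|ki].
    by have -> : i == ik by apply/eqP/val_inj.
  by rewrite hh//; case: ifP.
have -> : dot (\row_i (if i == ik then c else d 0 i)) h = dot d h0 + h 0 ik * c.
  rewrite /dot (bigD1 ik)//= [in RHS](bigD1 ik)//= !mxE eqxx mulr0 add0r addrC mulrC.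
  congr (_ + _); apply: eq_bigr => i /negPf ik'; rewrite !mxE ik'//.
rewrite {2}hE; set s := h 0 ik.
have [sn|sp|->] := ltgtP s 0; last first.
- by rewrite mul0r scale0r !addr0; exact: hd.
- have : c <= (f (h0 + s *: e) - dot d h0) / s by apply: ge_sup => //; exact: up.
  by rewrite ler_pdivlMr// => ?; lra.
- have : (dot d h0 - f (h0 - (- s) *: e)) / (- s) <= c.
    by apply: ub_le_sup => //; exists h0, (- s); rewrite oppr_gt0.
  by rewrite ler_pdivrMr ?oppr_gt0// scaleNr opprK => ?; lra.
Qed.

Lemma subdifferential_nonempty f x :
  convex_function [set: 'rV[R]_m] f -> subdifferential f x !=set0.
Proof.
move=> /convex_function_jensen cf.
have [||d hd] := @linear_minorant (fun h => f (x + h) - f x).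
- move=> y z t t01; have := cf (x + y) (x + z) t t01.
  have -> : t *: (x + y) + (1 - t) *: (x + z) = x + (t *: y + (1 - t) *: z).
    by apply/rowP => i; rewrite !mxE; ring.
  by lra.
- by rewrite addr0 subrr.
- exists d => y; have := hd (y - x); rewrite (addrC x) subrK; lra.
Qed.

Lemma pos_part_ge0 f x : 0 <= pos_part f x.
Proof. by rewrite /pos_part le_max lexx orbT. Qed.

(** On a short enough piece of the segment from [x] to [y] the positive part is
    positive, hence equal to [f], and convexity carries the inequality obtained
    there to the whole segment. *)
Lemma subdifferential_pos_part f x d : convex_function [set: 'rV[R]_m] f ->
  0 < pos_part f x -> subdifferential (pos_part f) x d ->
  subdifferential f x d.
Proof.
move=> /convex_function_jensen cf fx hd y.
have {}fx : 0 < f x by move: fx; rewrite /pos_part lt_max ltxx orbF.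
have posx : pos_part f x = f x by rewrite /pos_part max_l// ltW.
set a := dot d (y - x).
(* small enough for [f x + t * a] to remain positive *)
pose t := f x / (f x + `|a| + 1).
have den : 0 < f x + `|a| + 1 by have := normr_ge0 a; lra.
have t0 : 0 < t by exact: divr_gt0.
have tE : t * (f x + `|a| + 1) = f x by rewrite mulfVK// gt_eqF.
have t1 : t <= 1.
  rewrite ler_pdivrMr// mul1r; have := normr_ge0 a; lra.
have ta : 0 < f x + t * a.
  have : - `|a| <= a by rewrite lerNl -normrN ler_norm.
  nra.
have := hd (t *: y + (1 - t) *: x).
have -> : t *: y + (1 - t) *: x - x = t *: (y - x).
  by apply/rowP => i; rewrite !mxE; ring.
rewrite dotZr posx -/a => hpos.
have /(le_trans hpos) : pos_part f (t *: y + (1 - t) *: x) <=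
    t * f y + (1 - t) * f x.
  have pp : 0 < pos_part f (t *: y + (1 - t) *: x) by apply: lt_le_trans hpos.
  have -> : pos_part f (t *: y + (1 - t) *: x) = f (t *: y + (1 - t) *: x).
    rewrite /pos_part max_l//; move: pp.
    by rewrite /pos_part lt_max ltxx orbF => /ltW.
  by apply: cf; rewrite t1 ltW.
by move=> ?; rewrite -(ler_pM2l t0); lra.
Qed.

(** A subgradient at a point bounds the decrease from there to any other point,
    and subgradients exist everywhere; only their norm on [Y] is controlled. *)
Lemma pos_part_lipschitz f (Y : set 'rV[R]_m) (M : R) :
  convex_function [set: 'rV[R]_m] f ->
  (forall y d, Y y -> subdifferential f y d -> enorm d <= M) ->
  forall x y, Y x -> Y y -> `|pos_part f x - pos_part f y| <= M * enorm (x - y).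
Proof.
move=> cf hM.
have h x y : Y x -> Y y -> pos_part f x <= pos_part f y + M * enorm (x - y).
  move=> Yx Yy; have [d hd] := subdifferential_nonempty x cf.
  have := hd y; have := dot_le_enorm (- d) (y - x).
  rewrite enormN dotNl (enorm_distC y x).
  have := hM _ _ Yx hd; have := enorm_ge0 (x - y) => e0 dM le1 le2.
  have : enorm d * enorm (x - y) <= M * enorm (x - y) by rewrite ler_wpM2r.
  have M0 : 0 <= M * enorm (x - y) by rewrite mulr_ge0// (le_trans (enorm_ge0 d)).
  have := pos_part_ge0 f y.
  have : f y <= pos_part f y by rewrite /pos_part le_max lexx.
  move=> le3 le4 le5; rewrite {1}/pos_part ge_max; apply/andP; split; lra.
move=> x y Yx Yy; have := h _ _ Yx Yy; have := h _ _ Yy Yx.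
rewrite (enorm_distC y x) => *; rewrite ler_norml; apply/andP; split; lra.
Qed.

(** A relaxed Polyak step. Since [s] is feasible, the subgradient inequality gives
    [g <= dot d (x - s)], so that the step of length [beta * g / enorm d ^+ 2]
    decreases the squared distance to [s] by at least
    [beta * (2 - beta) * g ^+ 2 / enorm d ^+ 2]; a feasible point also forces
    [d] to be nonzero when [g] is positive. *)
Lemma feasibility_step f (Y : set 'rV[R]_m) (M beta : R)
    x (s : 'rV[R]_m) d (e : 'rV[R]_m) :
  convex_function [set: 'rV[R]_m] f ->
  closed Y -> convex_set Y -> 0 < M ->
  (forall y d, Y y -> subdifferential f y d -> enorm d <= M) ->
  0 < beta < 2 -> Y x -> Y s -> f s <= 0 ->
  (if 0 < pos_part f x then subdifferential (pos_part f) x d else d = e) ->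
  enorm (proj Y (x - (beta * (pos_part f x / enorm d ^+ 2)) *: d) - s) ^+ 2 <=
    enorm (x - s) ^+ 2 - beta * (2 - beta) / M ^+ 2 * pos_part f x ^+ 2.
Proof.
move=> cf clY cvY M0 hM b02 Yx Ys fs hd.
have Y0 : Y !=set0 by exists x.
set g := pos_part f x in hd *.
set st := (beta * _) *: d.
have := proj_contracts clY cvY Y0 (x - st) Ys.
rewrite -ler_sqr ?nnegrE ?enorm_ge0// => /le_trans; apply.
have [g0|g0] := ltP 0 g; last first.
  have gE0 : g = 0 by apply/eqP; rewrite eq_le g0 pos_part_ge0.
  by rewrite /st gE0 mul0r mulr0 scale0r subr0 expr0n/= mulr0 subr0.
rewrite g0 in hd.
have fs0 : pos_part f s = 0 by rewrite /pos_part max_r.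
have gd : g <= dot d (x - s).
  by have := hd s; rewrite fs0 -/g -(opprB x s) dotNr; lra.
have dM : enorm d <= M by apply: (hM _ _ Yx); exact: subdifferential_pos_part.
have d0 : 0 < enorm d.
  rewrite lt_neqAle enorm_ge0 andbT eq_sym; apply/negP => /eqP dn0.
  by have := dot_le_enorm d (x - s); rewrite dn0 mul0r; lra.
rewrite !enorm_sqr.
have -> : dot (x - st - s) (x - st - s) =
    dot (x - s) (x - s) - 2 * (beta * (g / enorm d ^+ 2)) * dot d (x - s) +
    (beta * (g / enorm d ^+ 2)) ^+ 2 * enorm d ^+ 2.
  rewrite /st; move: (beta * (g / _)) => k; rewrite enorm_sqr !dotE.
  by rewrite (dotC x d) (dotC s d) (dotC s x); ring.
have d20 : 0 < enorm d ^+ 2 by rewrite exprn_gt0.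
set D := enorm d ^+ 2 in d20 *.
have -> : (beta * (g / D)) ^+ 2 * D = beta ^+ 2 * (g ^+ 2 / D).
  by field; rewrite gt_eqF.
have le1 : g / D * g <= g / D * dot d (x - s).
  by rewrite ler_pM2l// divr_gt0.
have DM : D <= M ^+ 2 by rewrite ler_sqr ?nnegrE ?enorm_ge0 ?(ltW M0).
have le2 : g ^+ 2 / M ^+ 2 <= g ^+ 2 / D.
  by rewrite ler_pM2l ?exprn_gt0// lef_pV2 ?posrE ?exprn_gt0.
have -> : beta * (2 - beta) / M ^+ 2 * g ^+ 2 = beta * (2 - beta) * (g ^+ 2 / M ^+ 2).
  by ring.
have gE : g / D * g = g ^+ 2 / D by ring.
rewrite gE in le1.
move: le1 le2; set G := g ^+ 2 / D; set H := g ^+ 2 / M ^+ 2; set Q := g / D.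
set w := dot d _; set v := dot (x - s) _ => le1 le2.
have b0 : 0 < beta * (2 - beta) by nra.
nra.
Qed.

End convex_functions.

(** * Block vectors *)

Section blocks.
Context {R : realType} {J : nat} {n : 'I_J -> nat}.
Implicit Types x y : 'rV[R]_(\sum_j n j).

Lemma submxrowD x y j : submxrow (x + y) j = submxrow x j + submxrow y j.
Proof. by apply/rowP => i; rewrite !mxE. Qed.

Lemma submxrowN x j : submxrow (- x) j = - submxrow x j.
Proof. by apply/rowP => i; rewrite !mxE. Qed.

Lemma submxrowB x y j : submxrow (x - y) j = submxrow x j - submxrow y j.
Proof. by rewrite submxrowD submxrowN. Qed.

Lemma submxrowZ t x j : submxrow (t *: x) j = t *: submxrow x j.
Proof. by apply/rowP => i; rewrite !mxE. Qed.

Lemma dot_mulmx m (x y : 'rV[R]_m) : dot x y = (x *m y^T) 0 0.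
Proof. by rewrite mxE; apply: eq_bigr => i _; rewrite mxE. Qed.

Lemma dot_blocks x y : dot x y = \sum_j dot (submxrow x j) (submxrow y j).
Proof.
rewrite dot_mulmx -{1}(submxrowK x) -{1}(submxrowK y) tr_mxrow mul_mxrow_mxcol.
by rewrite summxE; apply: eq_bigr => j _; rewrite dot_mulmx.
Qed.

Lemma enorm_sqr_blocks x : enorm x ^+ 2 = \sum_j enorm (submxrow x j) ^+ 2.
Proof.
by rewrite enorm_sqr dot_blocks; apply: eq_bigr => j _; rewrite enorm_sqr.
Qed.

Lemma block_prod_proj (Y : forall j, set 'rV[R]_(n j)) x y :
  (forall j, closed (Y j)) -> (forall j, convex_set (Y j)) ->
  (forall j, Y j !=set0) ->
  (forall j, submxrow y j = proj (Y j) (submxrow x j)) ->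
  block_prod Y y.
Proof. by move=> ? ? ? h j /=; rewrite h; exact: proj_in. Qed.

Lemma block_prod_proj_variational (Y : forall j, set 'rV[R]_(n j)) x y z :
  (forall j, closed (Y j)) -> (forall j, convex_set (Y j)) ->
  (forall j, submxrow y j = proj (Y j) (submxrow x j)) ->
  block_prod Y z -> dot (x - y) (z - y) <= 0.
Proof.
move=> clY cvY h Yz; rewrite dot_blocks; apply: sumr_le0 => j _.
rewrite !submxrowB h; apply: proj_variational (Yz j) => //.
by exists (submxrow z j); exact: Yz.
Qed.

(** Replacing one block of the solution by a feasible point of that block keeps it
    feasible, so that the inequality splits over the blocks; the infimum of the
    Cauchy-Schwarz bound then gives the distance. *)
Lemma VI_solution_block (S : forall j, set 'rV[R]_(n j))
    (F : 'rV[R]_(\sum_j n j) -> 'rV[R]_(\sum_j n j)) xs j (v : 'rV[R]_(n j)) :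
  VI_solution (block_prod S) F xs ->
  - (enorm (submxrow (F xs) j) * dist v (S j)) <=
    dot (submxrow (F xs) j) (v - submxrow xs j).
Proof.
move=> [Sxs hxs]; set B := enorm _; set G := submxrow (F xs) j.
have S0 : S j !=set0 by exists (submxrow xs j); exact: Sxs.
have block s : S j s -> 0 <= dot G (s - submxrow xs j).
  move=> Ss.
  have [i_s eqs] : exists f : forall i, 'rV[R]_(n i), f j = s /\
      forall i, i != j -> f i = submxrow xs i.
    (* the two types of blocks agree only up to the equality [j = i] *)
    exists (fun i => if pselect (j = i) is left e
      then eq_rect j (fun i => 'rV[R]_(n i)) s i e else submxrow xs i).
    split=> [|i /eqP ij]; last first.
      by case: pselect => //= ji; case: ij.
    by case: pselect => // e; rewrite (eq_irrelevance e erefl).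
  pose y := \mxrow_i i_s i : 'rV[R]_(\sum_j n j).
  have := hxs y; rewrite dot_blocks (bigD1 j)//= [X in _ + X]big1 ?addr0; last first.
    move=> i ij; rewrite submxrowB mxrowK eqs.2// subrr.
    by rewrite -(scale0r 0) dotZr mul0r.
  rewrite submxrowB mxrowK eqs.1; apply => i /=; rewrite mxrowK.
  have [->|ij] := eqVneq i j; first by rewrite eqs.1.
  by rewrite eqs.2//; exact: Sxs.
have hv s : S j s -> - (B * enorm (v - s)) <= dot G (v - submxrow xs j).
  move=> Ss; have -> : v - submxrow xs j = (v - s) + (s - submxrow xs j).
    by rewrite subrKA.
  rewrite dotDr; have := block _ Ss; have := normr_dot_le G (v - s).
  by rewrite ler_norml -/B => /andP[+ _]; lra.
have [B0|B0] := eqVneq B 0.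
  by have [s Ss] := S0; have := hv _ Ss; rewrite B0 !mul0r.
have {}B0 : 0 < B by rewrite lt_neqAle eq_sym B0 enorm_ge0.
rewrite lerNl -ler_pdivrMl//; apply: dist_ge => // s Ss.
by rewrite ler_pdivrMl// lerNl; exact: hv.
Qed.

End blocks.

(** * The deterministic part of one iteration *)

Section korpelevich_step.
Context {R : realType} {J : nat} {n : 'I_J -> nat}.
Unset Implicit Arguments.
Variables (Y S : forall j, set 'rV[R]_(n j)).
Set Implicit Arguments.
Variable F : 'rV[R]_(\sum_j n j) -> 'rV[R]_(\sum_j n j).
Variables (L mu al : R) (x u v xs : 'rV[R]_(\sum_j n j)).
Hypotheses (clY : forall j : 'I_J, closed (Y j)) (cvY : forall j, convex_set (Y j)).
Hypothesis SY : forall j, S j `<=` Y j.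
Hypotheses (L0 : 0 < L) (mu0 : 0 < mu) (al0 : 0 < al).
Hypothesis alle : al <= 1 / (4 * (L + mu)).
Hypothesis lipF : forall y y', block_prod Y y -> block_prod Y y' ->
  enorm (F y - F y') <= L * enorm (y - y').
Hypothesis monoF : forall y y', block_prod Y y -> block_prod Y y' ->
  mu * enorm (y - y') ^+ 2 <= dot (F y - F y') (y - y').
Hypothesis hxs : VI_solution (block_prod S) F xs.
Hypothesis Yx : block_prod Y x.
Hypothesis uE : forall j,
  submxrow u j = proj (Y j) (submxrow x j - al *: submxrow (F x) j).
Hypothesis vE : forall j,
  submxrow v j = proj (Y j) (submxrow x j - al *: submxrow (F u) j).

Let B := enorm (F xs).

Let Y0 (j : 'I_J) : Y j !=set0. Proof. by exists (submxrow x j); exact: Yx. Qed.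

Let Yxs : block_prod Y xs. Proof. by move=> j; apply: SY; exact: hxs.1. Qed.

Let uE' (j : 'I_J) : submxrow u j = proj (Y j) (submxrow (x - al *: F x) j).
Proof. by rewrite uE submxrowB submxrowZ. Qed.

Let vE' (j : 'I_J) : submxrow v j = proj (Y j) (submxrow (x - al *: F u) j).
Proof. by rewrite vE submxrowB submxrowZ. Qed.

Let Yu : block_prod Y u. Proof. exact: block_prod_proj uE'. Qed.

Let Yv : block_prod Y v. Proof. exact: block_prod_proj vE'. Qed.

Lemma step_size_small : al * (L + mu) <= 1 / 4.
Proof.
have Lm : 0 < L + mu by exact: addr_gt0.
have := alle; rewrite -(ler_pM2r Lm) => /le_trans; apply.
by rewrite le_eqVlt; apply/orP; left; apply/eqP; field; rewrite gt_eqF.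
Qed.

(** The classical extragradient estimate. The obtuse angles at the projections [u]
    and [v], tested at [v] and at [xs], are combined with the strong monotonicity
    at [u]; the Lipschitz bound on [F x - F u] is absorbed because the step is
    small. As [xs] solves the inequality on a smaller set than the one that is
    projected on, the term [dot (F xs) (v - xs)] has no sign and is kept. *)
Lemma korpelevich_descent :
  enorm (v - xs) ^+ 2 <= (1 - al * mu) * enorm (x - xs) ^+ 2
    - enorm (u - v) ^+ 2 / 2 + 2 * al * B * enorm (u - v)
    - 2 * al * dot (F xs) (v - xs).
Proof.
have hu := block_prod_proj_variational clY cvY uE' Yv.
have hv := block_prod_proj_variational clY cvY vE' Yxs.
have hm := monoF Yu Yxs.
have hl := lipF Yx Yu.
have hs := step_size_small.
pose p := x - u; pose r := u - v; pose e := u - xs.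
have hlr : - (L * enorm p * enorm r) <= dot (F x - F u) r.
  have := normr_dot_le (F x - F u) r; rewrite ler_norml => /andP[+ _].
  by apply: le_trans; rewrite lerN2 ler_wpM2r ?enorm_ge0.
have hBr : - (B * enorm r) <= dot (F xs) r.
  by have := normr_dot_le (F xs) r; rewrite ler_norml => /andP[].
have hpe : 0 <= dot (p - e) (p - e) by exact: dot_ge0.
have hvE : v - xs = e - r by apply/rowP => i; rewrite !mxE; ring.
have hxE : x - xs = p + e by apply/rowP => i; rewrite !mxE; ring.
have hxu : x - al *: F x - u = p - al *: F x by apply/rowP => i; rewrite !mxE; ring.
have hvu : v - u = - r by apply/rowP => i; rewrite !mxE; ring.
have hxv : x - al *: F u - v = p + r - al *: F u.
  by apply/rowP => i; rewrite !mxE; ring.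
have hxsv : xs - v = r - e by apply/rowP => i; rewrite !mxE; ring.
have pr : 0 <= enorm p ^+ 2 + enorm r ^+ 2 - 2 * enorm p * enorm r.
  by have := sqr_ge0 (enorm p - enorm r); lra.
move: hu hv hm hl; rewrite hvE hxE hxu hvu hxv hxsv.
rewrite -[x - u]/p -[u - xs]/e -[u - v]/r.
move: (p) (r) (e) hlr hBr hpe pr => {p r e hvE hxE hxu hvu hxv hxsv}p r e.
have n1 := enorm_ge0 p; have n2 := enorm_ge0 r.
rewrite !enorm_sqr !dotE (dotC e p) (dotC e r).
set pp := dot p p; set rr := dot r r; set ee := dot e e.
set np := enorm p; set nr := enorm r.
move=> hlr hBr hpe pr hu hv hm hl.
have hlr' : - (al * L * (pp + rr)) <= 2 * al * (dot (F x) r - dot (F u) r).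
  have hnn : L * (2 * np * nr) <= L * (pp + rr) by rewrite ler_pM2l//; lra.
  have : - (L * (pp + rr)) <= 2 * (dot (F x) r - dot (F u) r) by lra.
  by rewrite -(ler_pM2l al0); lra.
have hm' : al * mu * ee <= al * (dot (F u) e - dot (F xs) e).
  by rewrite -mulrA ler_pM2l.
have hBr' : - (al * B * nr) <= al * dot (F xs) r.
  by rewrite -mulrA -mulrN ler_pM2l.
have hpe' : al * mu * (pp + ee + 2 * dot p e) <= al * mu * (2 * pp + 2 * ee).
  by rewrite ler_pM2l ?mulr_gt0//; lra.
have pp0 : 0 <= pp by exact: dot_ge0.
have rr0 : 0 <= rr by exact: dot_ge0.
have alL : 0 < al * L by exact: mulr_gt0.
have almu : 0 < al * mu by exact: mulr_gt0.
have hpp : 0 <= (1 - al * L - 2 * (al * mu)) * pp by rewrite mulr_ge0//; lra.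
have hrr : 0 <= (1 / 2 - al * L) * rr by rewrite mulr_ge0//; lra.
lra.
Qed.

(** Moving [v] to a feasible point costs at most [enorm (F xs)] times the distance,
    and Young's inequality trades this for an arbitrarily small multiple [q] of the
    squared distance and a term of order [al ^+ 2]. *)
Lemma korpelevich_step_dist (q : R) : 0 < q ->
  enorm (v - xs) ^+ 2 <= (1 - al * mu) * enorm (x - xs) ^+ 2
    + (2 * B ^+ 2 + B ^+ 2 / q) * al ^+ 2
    + q * \sum_j dist (submxrow v j) (S j) ^+ 2.
Proof.
move=> q0; apply: (le_trans korpelevich_descent).
have hB : - (2 * al * dot (F xs) (v - xs)) <=
    B ^+ 2 / q * al ^+ 2 + q * \sum_j dist (submxrow v j) (S j) ^+ 2.
  rewrite dot_blocks /B enorm_sqr_blocks mulr_sumr !mulr_suml mulr_sumr -big_split/=.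
  rewrite -sumrN; apply: ler_sum => j _.
  have := VI_solution_block (submxrow v j) hxs; rewrite submxrowB.
  set b := enorm _; set D := dist _ _; set w := dot _ _ => h.
  have : 0 <= (b * al - q * D) ^+ 2 / q by rewrite divr_ge0 ?sqr_ge0 ?ltW.
  have -> : (b * al - q * D) ^+ 2 / q = b ^+ 2 / q * al ^+ 2 + q * D ^+ 2 - 2 * al * (b * D).
    by field; rewrite gt_eqF.
  have h2 : - (2 * al * (b * D)) <= 2 * al * w.
    by rewrite -mulrN ler_pM2l ?mulr_gt0.
  rewrite -/D; lra.
have : 0 <= (enorm (u - v) - 2 * al * B) ^+ 2 by exact: sqr_ge0.
by lra.
Qed.

Lemma korpelevich_step_bound :
  enorm (v - xs) ^+ 2 <= 2 * enorm (x - xs) ^+ 2 + 8 * B ^+ 2 * al ^+ 2.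
Proof.
have h := korpelevich_descent.
have h1 : 0 <= (enorm (u - v) - 2 * al * B) ^+ 2 by exact: sqr_ge0.
have h2 : 0 <= (enorm (v - xs) - 2 * al * B) ^+ 2 by exact: sqr_ge0.
have h3 : - (B * enorm (v - xs)) <= dot (F xs) (v - xs).
  by have := normr_dot_le (F xs) (v - xs); rewrite ler_norml => /andP[].
have h4 : 0 <= al * mu * enorm (x - xs) ^+ 2.
  by apply: mulr_ge0; [apply/ltW; exact: mulr_gt0|exact: sqr_ge0].
have h5 : - (2 * al * (B * enorm (v - xs))) <= 2 * al * dot (F xs) (v - xs).
  by rewrite -mulrN ler_pM2l ?mulr_gt0.
by have := sqr_ge0 (enorm (x - xs)); lra.
Qed.

End korpelevich_step.

(** * Integrals of nonnegative real functions *)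

Section nonnegative_integrals.
Context {R : realType} {d : measure_display} {T : measurableType d}.
Variable P : probability T R.
Implicit Types (f g : T -> R) (A : set T).

Let mE f A : measurable_fun setT f -> measurable_fun A (EFin \o f).
Proof. by move=> mf; apply/measurable_EFinP; exact: measurable_funTS. Qed.

Lemma integralr_mono A f g : measurable A ->
  measurable_fun setT f -> measurable_fun setT g ->
  (forall w, 0 <= f w) -> (forall w, f w <= g w) ->
  (\int[P]_(w in A) (f w)%:E <= \int[P]_(w in A) (g w)%:E)%E.
Proof.
move=> mA mf mg f0 fg; apply: ge0_le_integral => // [w _|||w _];
  by [rewrite lee_fin|exact: mE].
Qed.

Lemma integralr_add A f g : measurable A ->
  measurable_fun setT f -> measurable_fun setT g ->
  (forall w, 0 <= f w) -> (forall w, 0 <= g w) ->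
  (\int[P]_(w in A) (f w + g w)%:E =
   \int[P]_(w in A) (f w)%:E + \int[P]_(w in A) (g w)%:E)%E.
Proof.
move=> mA mf mg f0 g0; under eq_integral do rewrite EFinD.
by apply: ge0_integralD => // [w _||w _|]; by [rewrite lee_fin|exact: mE].
Qed.

Lemma integralr_sum A (I : finType) (h : I -> T -> R) : measurable A ->
  (forall i, measurable_fun setT (h i)) -> (forall i w, 0 <= h i w) ->
  (\int[P]_(w in A) (\sum_i h i w)%:E =
   \sum_i \int[P]_(w in A) (h i w)%:E)%E.
Proof.
move=> mA mh h0; under eq_integral do rewrite -sumEFin.
by apply: ge0_integral_sum => // [i|i w _]; by [rewrite lee_fin|exact: mE].
Qed.

Lemma integralr_scale A f (k : R) : measurable A ->
  measurable_fun setT f -> (forall w, 0 <= f w) -> 0 <= k ->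
  (\int[P]_(w in A) (k * f w)%:E = k%:E * \int[P]_(w in A) (f w)%:E)%E.
Proof.
move=> mA mf f0 k0; under eq_integral do rewrite EFinM.
by apply: ge0_integralZl_EFin => // [w _|]; by [rewrite lee_fin|exact: mE].
Qed.

Lemma integralr_cst A (k : R) : measurable A ->
  (\int[P]_(w in A) k%:E = k%:E * P A)%E.
Proof. by move=> mA; rewrite -(integral_cst P mA k%:E). Qed.

Lemma integralr_cst_le A (k : R) : measurable A -> 0 <= k ->
  (\int[P]_(w in A) k%:E <= k%:E)%E.
Proof.
move=> mA k0; rewrite integralr_cst// -[leRHS]mule1.
by apply: lee_pmul => //; exact: probability_le1.
Qed.

Lemma integralr_ge0 A f : (forall w, 0 <= f w) ->
  (0 <= \int[P]_(w in A) (f w)%:E)%E.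
Proof. by move=> f0; apply: integral_ge0 => w _; rewrite lee_fin. Qed.

Lemma integralr_subset A f : measurable A ->
  measurable_fun setT f -> (forall w, 0 <= f w) ->
  (\int[P]_(w in A) (f w)%:E <= \int[P]_w (f w)%:E)%E.
Proof.
move=> mA mf f0; apply: ge0_subset_integral => //;
  by [exact: mE|move=> w _; rewrite lee_fin].
Qed.

End nonnegative_integrals.

(** From [f <= e + f ^+ 2 / e]. *)
Lemma mean_cvg0_of_sqr {R : realType} {d : measure_display} {T : measurableType d}
    (P : probability T R) (f : nat -> T -> R) :
  (forall k, measurable_fun [set: T] (f k)) -> (forall k w, 0 <= f k w) ->
  (\int[P]_w (f k w ^+ 2)%:E)%E @[k --> \oo] --> 0%E ->
  ('E_P[f k])%E @[k --> \oo] --> 0%E.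
Proof.
move=> mf f0 /fine_cvgP[hfin /cvgrPdist_le hf].
have small e : 0 < e -> \forall k \near \oo, ('E_P[f k] <= e%:E)%E.
  move=> e0; pose h := e / 2; have h0 : 0 < h by rewrite divr_gt0.
  near=> k.
  have fin : (\int[P]_w (f k w ^+ 2)%:E)%E \is a fin_num by near: k.
  have : `|0 - fine (\int[P]_w (f k w ^+ 2)%:E)%E| <= h ^+ 2.
    by near: k; apply: hf; exact: exprn_gt0.
  rewrite sub0r normrN ger0_norm; last first.
    by apply: fine_ge0; apply: integralr_ge0 => w; exact: sqr_ge0.
  rewrite -lee_fin fineK// => hint; rewrite unlock.
  apply: (@le_trans _ _ (\int[P]_w (h + h^-1 * f k w ^+ 2)%:E)%E).
    apply: integralr_mono => // [|w].
      by apply: measurable_funD => //; apply: measurable_funM => //;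
    exact: measurable_funX.
    rewrite -(ler_pM2l h0) mulrDr mulVKf ?gt_eqF//.
    have := sqr_ge0 (h - f k w); have := mulr_ge0 (ltW h0) (f0 k w).
    by rewrite !expr2; lra.
  have hV : 0 <= h^-1 by rewrite invr_ge0 ltW.
  rewrite integralr_add//; last 3 first.
  - by apply: measurable_funM => //; exact: measurable_funX.
  - by move=> _; exact: ltW.
  - by move=> w; rewrite mulr_ge0 ?sqr_ge0.
  rewrite (@integralr_scale _ _ _ P _ (fun w => f k w ^+ 2))//; last 2 first.
  - exact: measurable_funX.
  - by move=> w; exact: sqr_ge0.
  have -> : e%:E = (h%:E + h^-1%:E * (h ^+ 2)%:E)%E.
    by rewrite -EFinM -EFinD expr2 mulKf ?gt_eqF// /h -splitr.
  apply: leeD; first by apply: integralr_cst_le => //; exact: ltW.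
  by apply: lee_wpmul2l; rewrite ?lee_fin.
have E0 k : (0 <= 'E_P[f k])%E by rewrite unlock; exact: integralr_ge0.
apply/fine_cvgP; split.
  apply: filterS (small 1 ltr01) => k h; rewrite ge0_fin_numE//.
  by rewrite (le_lt_trans h)// ltry.
apply/cvgrPdist_le => e e0; apply: filterS (small e e0) => k h.
rewrite sub0r normrN ger0_norm ?fine_ge0// -lee_fin fineK//.
by rewrite ge0_fin_numE// (le_lt_trans h)// ltry.
Unshelve. all: by end_near. Qed.

(** * Random vectors *)

Section random_vectors.
Context {R : realType} {d : measure_display} {T : measurableType d} {m : nat}.
Implicit Types (X : T -> 'rV[R]_m) (C : set 'rV[R]_m).

Lemma measurable_dot X X' : random_vector X -> random_vector X' ->
  measurable_fun setT (fun w => dot (X w) (X' w)).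
Proof.
by move=> mX mX'; apply: measurable_sum => i; apply: measurable_funM.
Qed.

Lemma measurable_inv (f : T -> R) :
  (forall w, 0 <= f w) -> measurable_fun setT f ->
  measurable_fun setT (fun w => (f w)^-1).
Proof.
move=> f0 mf; under eq_fun do rewrite -powR_inv1//.
exact: (measurableT_comp (measurable_powR (-1))).
Qed.

Lemma random_vectorB X X' : random_vector X -> random_vector X' ->
  random_vector (fun w => X w - X' w).
Proof.
move=> mX mX' i; rewrite (_ : (fun _ => _) = (fun w => X w 0 i - X' w 0 i)).
  exact: measurable_funB.
by apply/funext => w; rewrite !mxE.
Qed.

Lemma random_vectorZ (k : T -> R) X : measurable_fun setT k -> random_vector X ->
  random_vector (fun w => k w *: X w).
Proof.
move=> mk mX i; rewrite (_ : (fun _ => _) = (fun w => k w * X w 0 i)).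
  exact: measurable_funM.
by apply/funext => w; rewrite !mxE.
Qed.

Lemma random_vector_cst (x : 'rV[R]_m) : random_vector (fun _ : T => x).
Proof. by move=> i; exact: measurable_cst. Qed.

Lemma measurable_enorm_sqr X : random_vector X ->
  measurable_fun setT (fun w => enorm (X w) ^+ 2).
Proof.
move=> mX; under eq_fun do rewrite enorm_sqr.
exact: measurable_dot.
Qed.

(** Cutting the space into cubes of side [delta / (m + 1)] yields countably many
    cells of diameter at most [delta]; each cell met by the values of [X] is
    represented by one of those values, which therefore lies in [C]. *)
Lemma countable_approximation C X delta : 0 < delta ->
  random_vector X -> (forall w, C (X w)) ->
  exists (r : T -> nat) (p : nat -> 'rV[R]_m),
  [/\ forall i, measurable (r @^-1` [set i]), forall i, C (p i)
    & forall w, enorm (X w - p (r w)) <= delta].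
Proof.
move=> d0 mX CX; pose h := delta / m.+1%:R.
have h0 : 0 < h by rewrite divr_gt0.
pose cell w : 'rV[int]_m := \row_i Num.floor (X w 0 i / h).
pose r w := pickle (cell w).
exists r, (fun i => X (xget point [set w | r w = i])); split => //.
- move=> i.
  have [[c ci]|noc] := pselect (exists c : 'rV[int]_m, pickle c = i); last first.
    rewrite (_ : _ @^-1` _ = set0) //; apply/seteqP; split => // w /= rw.
    by apply: noc; exists (cell w).
  rewrite (_ : _ @^-1` _ = \bigcap_(t in [set: 'I_m])
     ((fun w => X w 0 t / h) @^-1` `[(c 0 t)%:~R, (c 0 t + 1)%:~R[%classic)).
    apply: fin_bigcap_measurable => // t _; rewrite -[_ @^-1` _]setTI.
    by apply: measurable_funM => //; exact: measurable_itv.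
  apply/seteqP; split=> [w /= rw t _ /=|w /= hw].
    have <- : cell w = c by apply: (pcan_inj pickleK); rewrite ci.
    by rewrite mxE in_itv/=; exact: floor_itv.
  rewrite -ci; congr pickle; apply/rowP => t; rewrite mxE.
  by apply: floor_def; have := hw t I; rewrite /= in_itv.
- move=> w; set w' := xget _ _.
  have /= rw' : [set v | r v = r w] w' by apply: xgetPex; exists w.
  have cw : cell w' = cell w by exact: (pcan_inj pickleK).
  apply: (le_trans (enorm_le_sum _)).
  apply: (@le_trans _ _ (\sum_(i < m) h)); last first.
    rewrite sumr_const card_ord -mulr_natr /h mulrAC ler_pdivrMr//.
    by rewrite ler_pM2l// ler_nat.
  apply: ler_sum => i _; rewrite !mxE.
  have /rowP/(_ i) := cw; rewrite !mxE => fE.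
  have := floor_itv (X w 0 i / h); have := floor_itv (X w' 0 i / h); rewrite fE.
  set k := Num.floor _; rewrite intrD => /andP[a1 a2] /andP[b1 b2].
  have : `|X w 0 i / h - X w' 0 i / h| <= 1.
    by rewrite ler_norml; apply/andP; split; lra.
  by rewrite -mulrBl normrM normfV (gtr0_norm h0) ler_pdivrMr// mul1r.
Qed.

Lemma measurable_countable_choice (r : T -> nat) (p : nat -> 'rV[R]_m)
    (G : T -> 'rV[R]_m -> R) :
  (forall i, measurable (r @^-1` [set i])) ->
  (forall i, measurable_fun setT (G^~ (p i))) ->
  measurable_fun setT (fun w => G w (p (r w))).
Proof.
move=> mr mG _ B mB; rewrite setTI.
rewrite (_ : _ @^-1` _ =
   \bigcup_i (r @^-1` [set i] `&` (G^~ (p i)) @^-1` B)).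
  apply: bigcup_measurable => i _; apply: measurableI => //.
  by rewrite -[X in measurable X]setTI; exact: mG.
by apply/seteqP; split=> [w Bw|w [i _ [/= -> //]]]; exists (r w).
Qed.

(** A function that is measurable in the sample point and Lipschitz in the
    vector is a pointwise limit of functions evaluated at countably many
    vectors. *)
Lemma measurable_lipschitz_comp C X (G : T -> 'rV[R]_m -> R) K :
  random_vector X -> (forall w, C (X w)) ->
  (forall y, C y -> measurable_fun setT (G^~ y)) ->
  (forall w y y', C y -> C y' -> `|G w y - G w y'| <= K * enorm (y - y')) ->
  measurable_fun setT (fun w => G w (X w)).
Proof.
move=> mX CX mG lipG.
have d0 k : 0 < k.+1%:R^-1 :> R by rewrite invr_gt0.
have /choice[rp hrp] : forall k, exists rp : (T -> nat) * (nat -> 'rV[R]_m),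
    [/\ forall i, measurable (rp.1 @^-1` [set i]), forall i, C (rp.2 i)
      & forall w, enorm (X w - rp.2 (rp.1 w)) <= k.+1%:R^-1].
  move=> k; have [r [p h]] := countable_approximation (d0 k) mX CX.
  by exists (r, p).
apply: (@measurable_fun_cvg _ _ _ _ (fun k w => G w ((rp k).2 ((rp k).1 w)))).
  move=> k; have [mr Cp _] := hrp k; apply: measurable_countable_choice => // i.
  exact: mG.
move=> w _; apply/cvgrPdist_le => e e0.
have K0 : 0 < `|K| + 1 by rewrite ltr_pwDr.
near=> k.
have [_ Cp hp] := hrp k.
apply: (le_trans (lipG _ _ _ (CX w) (Cp _))).
apply: (@le_trans _ _ ((`|K| + 1) * k.+1%:R^-1)).
  apply: (@le_trans _ _ ((`|K| + 1) * enorm (X w - (rp k).2 ((rp k).1 w)))).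
    by rewrite ler_wpM2r ?enorm_ge0// (le_trans (ler_norm K))// lerDl.
  by rewrite ler_pM2l.
rewrite -ler_pdivlMl// mulrC.
by apply/ltW; near: k; exact: (near_infty_natSinv_lt (PosNum (divr_gt0 e0 K0))).
Unshelve. all: by end_near. Qed.

Lemma measurable_enorm X : random_vector X ->
  measurable_fun setT (fun w => enorm (X w)).
Proof.
move=> mX.
apply: (@measurable_lipschitz_comp setT X (fun _ => @enorm R m) 1) => //.
by move=> _ y y' _ _; rewrite mul1r; exact: enorm_lipschitz.
Qed.

Lemma random_vector_proj C X : closed C -> convex_set C -> C !=set0 ->
  random_vector X -> random_vector (fun w => proj C (X w)).
Proof.
move=> clC cvC C0 mX i.
apply: (@measurable_lipschitz_comp setT X (fun _ y => proj C y 0 i) 1) => //.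
move=> w y y' _ _; rewrite mul1r.
have := normr_coord_le_enorm (proj C y - proj C y') i; rewrite !mxE => /le_trans; apply.
exact: proj_nonexpansive.
Qed.

End random_vectors.

Section block_random_vectors.
Context {R : realType} {d : measure_display} {T : measurableType d}
  {J : nat} {n : 'I_J -> nat}.

Lemma random_vector_submxrow 
    (X : T -> 'rV[R]_(\sum_j n j)) j :
  random_vector X -> random_vector (fun w => submxrow (X w) j).
Proof. by move=> mX i; under eq_fun do rewrite mxE; exact: mX. Qed.

Lemma random_vector_blocks 
    (X : T -> 'rV[R]_(\sum_j n j)) :
  (forall j, random_vector (fun w => submxrow (X w) j)) -> random_vector X.
Proof.
move=> mX i; have := mX (tagnat.sig1 i) (tagnat.sig2 i).
by under eq_fun do rewrite mxE tagnat.sig2K.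
Qed.

End block_random_vectors.

(** Young's inequality on the cross term of [(b + K * delta) ^+ 2]. *)
Lemma sqr_le_perturb {R : realType} (a b K delta : R) :
  0 < delta -> 0 <= b -> 0 <= a -> a <= b + K * delta ->
  a ^+ 2 <= (1 + delta) * b ^+ 2 + K ^+ 2 * (delta + delta ^+ 2).
Proof.
move=> d0 b0 a0 ab.
have : a ^+ 2 <= (b + K * delta) ^+ 2 by rewrite ler_sqr ?nnegrE// (le_trans a0).
have : 0 <= delta * (b - K) ^+ 2 by rewrite mulr_ge0 ?sqr_ge0// ltW.
by lra.
Qed.

Section freezing.
Context {R : realType} {d : measure_display} {T : measurableType d} {m : nat}.
Variables (P : probability T R) (G : set (set T)).
Hypothesis GT : <<s G >> `<=` measurable.

Lemma sub_measurable_fun d' (T' : measurableType d')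
    (f : g_sigma_algebraType G -> T') :
  measurable_fun setT f -> measurable_fun [set: T] (f : T -> T').
Proof.
move=> mf _ B mB; apply: GT; have := mf measurableT B mB.
by rewrite setTI.
Qed.

(** A bound that holds for each fixed vector, on the events of a
    sub-sigma-algebra, survives the substitution of a random vector that is
    measurable for it: split an event according to the cell containing the vector,
    and let the diameter of the cells tend to 0. *)
Lemma freezing (C : set 'rV[R]_m) (X : g_sigma_algebraType G -> 'rV[R]_m)
    (a : 'rV[R]_m -> R) (b : T -> 'rV[R]_m -> R) (c Ka Kb : R) :
  0 < c -> 0 <= Ka -> 0 <= Kb ->
  random_vector X -> (forall w, C (X w)) ->
  (forall y, 0 <= a y) -> (forall w y, 0 <= b w y) ->
  (forall y, C y -> measurable_fun setT (b^~ y)) ->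
  (forall y y', C y -> C y' -> `|a y - a y'| <= Ka * enorm (y - y')) ->
  (forall w y y', C y -> C y' -> `|b w y - b w y'| <= Kb * enorm (y - y')) ->
  (forall A y, <<s G >> A -> C y ->
    (\int[P]_(w in A) (a y ^+ 2)%:E <=
      c%:E * \int[P]_(w in A) (b w y ^+ 2)%:E)%E) ->
  forall A, <<s G >> A ->
    (\int[P]_(w in A) (a (X w) ^+ 2)%:E <=
      c%:E * \int[P]_(w in A) (b w (X w) ^+ 2)%:E)%E.
Proof.
move=> c0 Ka0 Kb0 mX CX a0 b0 mb lipa lipb hab A GA.
have mA : measurable A by exact: GT.
have mX' : random_vector (X : T -> 'rV[R]_m).
  by move=> i; exact: sub_measurable_fun (mX i).
have maX : measurable_fun [set: T] (fun w => a (X w)).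
  exact: (measurable_lipschitz_comp (G := fun _ => a) mX' CX _ (fun _ => lipa)).
have mbX : measurable_fun [set: T] (fun w => b w (X w)).
  exact: (measurable_lipschitz_comp mX' CX mb lipb).
have [->|finI] := eqVneq (\int[P]_(w in A) (b w (X w) ^+ 2)%:E)%E +oo%E.
  by rewrite gt0_muley ?lte_fin// leey.
set I := (\int[P]_(w in A) (b w (X w) ^+ 2)%:E)%E in finI *.
have I0 : (0 <= I)%E by apply: integralr_ge0 => w; rewrite sqr_ge0.
have IE : I = (fine I)%:E.
  by rewrite fineK// ge0_fin_numE// ltey.
set J := fine I in IE; rewrite IE in I0 *; rewrite lee_fin in I0.
(* bounds the total coefficient of [delta], as [delta <= 1] *)
pose M := 3 * c * J + 2 * Ka ^+ 2 + 4 * c * Kb ^+ 2 + 1.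
suff bound delta : 0 < delta -> delta <= 1 ->
    (\int[P]_(w in A) (a (X w) ^+ 2)%:E <= (c * J + M * delta)%:E)%E.
  apply/lee_addgt0Pr => e e0.
  have M0 : 0 < M.
    have := mulr_ge0 (ltW c0) I0; have := sqr_ge0 Ka.
    by have := mulr_ge0 (ltW c0) (sqr_ge0 Kb); rewrite /M; lra.
  have := bound (Num.min 1 (e / M)).
  rewrite lt_min ge_min lexx ltr01 divr_gt0// => /(_ isT isT) /le_trans; apply.
  rewrite -EFinM -EFinD lee_fin lerD2l -ler_pdivlMl// mulrC.
  by rewrite ge_min lexx orbT.
move=> d0 d1.
have [r [p [mr Cp hp]]] := countable_approximation d0 mX CX.
have lip_le t1 t2 K e : 0 <= K -> `|t1 - t2| <= K * e -> e <= delta ->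
    t1 <= t2 + K * delta.
  rewrite ler_norml => K0 /andP[_ h] ed.
  by have := ler_wpM2l K0 ed; lra.
have mr' i : measurable (r @^-1` [set i] : set T) by apply: GT; exact: mr.
have map : measurable_fun [set: T] (fun w => a (p (r w))).
  by apply: (@measurable_countable_choice R d T m r p (fun _ => a)) => // i;
    exact: measurable_cst.
have mbp : measurable_fun [set: T] (fun w => b w (p (r w))).
  by apply: (@measurable_countable_choice R d T m r p b) => // i; exact: mb.
have step1 w : a (X w) ^+ 2 <=
    (1 + delta) * a (p (r w)) ^+ 2 + Ka ^+ 2 * (delta + delta ^+ 2).
  apply: sqr_le_perturb => //.
  exact: lip_le Ka0 (lipa _ _ (CX w) (Cp (r w))) (hp w).
have step2 w : b w (p (r w)) ^+ 2 <=
    (1 + delta) * b w (X w) ^+ 2 + Kb ^+ 2 * (delta + delta ^+ 2).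
  apply: sqr_le_perturb => //; apply: lip_le Kb0 _ (hp w).
  by rewrite distrC; exact: lipb.
have cells : (\int[P]_(w in A) (a (p (r w)) ^+ 2)%:E <=
    c%:E * \int[P]_(w in A) (b w (p (r w)) ^+ 2)%:E)%E.
  have AE : A = \bigcup_i (A `&` r @^-1` [set i]).
    by apply/seteqP; split=> [w Aw|w [i _ []//]]; exists (r w).
  have mAr i : measurable (A `&` r @^-1` [set i]) by exact: measurableI.
  have triv : trivIset setT (fun i => A `&` r @^-1` [set i]).
    by apply/trivIsetP => i j _ _ ij; apply/seteqP;
      split => // w [[_ /= ri] [_ /= rj]];
      move: ij; rewrite -ri -rj eqxx.
  rewrite {1 2}AE !ge0_integral_bigcup//.
  - rewrite -nneseriesZl => [|i _]; last by apply: integralr_ge0 => w; rewrite sqr_ge0.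
    apply: lee_nneseries => [i _ _|i _].
      by apply: integralr_ge0 => w; rewrite sqr_ge0.
    rewrite (eq_integral (fun=> (a (p i) ^+ 2)%:E)); last first.
      by move=> w /set_mem[_ /= ->].
    rewrite [X in (_ <= _ * X)%E](eq_integral
      (fun w => (b w (p i) ^+ 2)%:E)); last first.
      by move=> w /set_mem[_ /= ->].
    apply: hab => //; exact: (@measurableI _ (g_sigma_algebraType G) A).
  - by apply/measurable_EFinP; apply: measurable_funTS; exact: measurable_funX.
  - by move=> w _; rewrite lee_fin sqr_ge0.
  - by apply/measurable_EFinP; apply: measurable_funTS; exact: measurable_funX.
  - by move=> w _; rewrite lee_fin sqr_ge0.
have dd : 0 <= delta + delta ^+ 2 by rewrite addr_ge0 ?sqr_ge0 ?(ltW d0).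
have d1' : 0 <= 1 + delta by lra.
have le1 : (\int[P]_(w in A) (a (X w) ^+ 2)%:E <=
    (1 + delta)%:E * \int[P]_(w in A) (a (p (r w)) ^+ 2)%:E
    + (Ka ^+ 2 * (delta + delta ^+ 2))%:E)%E.
  rewrite -integralr_scale// ?sqr_ge0//; last 2 first.
  - exact: measurable_funX.
  - by move=> w; rewrite sqr_ge0.
  apply: le_trans (leeD (lexx _) (integralr_cst_le P mA (mulr_ge0 (sqr_ge0 Ka) dd))).
  rewrite -integralr_add//; last 3 first.
  - by apply: measurable_funM => //; exact: measurable_funX.
  - by move=> w; rewrite mulr_ge0 ?sqr_ge0.
  - by move=> w; rewrite mulr_ge0 ?sqr_ge0.
  apply: integralr_mono => //; last by move=> w; rewrite sqr_ge0.
    exact: measurable_funX.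
  by apply: measurable_funD => //; apply: measurable_funM => //;
    exact: measurable_funX.
have le2 : (\int[P]_(w in A) (b w (p (r w)) ^+ 2)%:E <=
    ((1 + delta) * J + Kb ^+ 2 * (delta + delta ^+ 2))%:E)%E.
  rewrite EFinD EFinM -IE /I -integralr_scale//; last 2 first.
  - exact: measurable_funX.
  - by move=> w; rewrite sqr_ge0.
  apply: le_trans (leeD (lexx _) (integralr_cst_le P mA (mulr_ge0 (sqr_ge0 Kb) dd))).
  rewrite -integralr_add//; last 3 first.
  - by apply: measurable_funM => //; exact: measurable_funX.
  - by move=> w; rewrite mulr_ge0 ?sqr_ge0.
  - by move=> w; rewrite mulr_ge0 ?sqr_ge0.
  apply: integralr_mono => //; last by move=> w; rewrite sqr_ge0.
    exact: measurable_funX.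
  by apply: measurable_funD => //; apply: measurable_funM => //;
    exact: measurable_funX.
apply: (le_trans le1).
apply: (@le_trans _ _ ((1 + delta)%:E *
    (c%:E * ((1 + delta) * J + Kb ^+ 2 * (delta + delta ^+ 2))%:E)
    + (Ka ^+ 2 * (delta + delta ^+ 2))%:E)%E).
  apply: leeD => //; apply: lee_pmul => //.
  - by apply: integralr_ge0 => w; rewrite sqr_ge0.
  - apply: (le_trans cells); apply: lee_pmul => //; rewrite ?lee_fin ?(ltW c0)//.
    by apply: integralr_ge0 => w; rewrite sqr_ge0.
rewrite -!EFinM -EFinD lee_fin /M.
have cJ : 0 <= c * J by rewrite mulr_ge0 ?(ltW c0).
have cK : 0 <= c * Kb ^+ 2 by rewrite mulr_ge0 ?(ltW c0) ?sqr_ge0.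
have K0 := sqr_ge0 Ka.
have d2 : delta ^+ 2 <= delta by rewrite expr2 ler_piMr// ltW.
have d3 : delta ^+ 3 <= delta.
  by rewrite exprS (le_trans _ d2)// expr2 ler_wpM2l// ?(ltW d0)// -expr2.
have := ler_wpM2l cJ d2; have := ler_wpM2l cK d2; have := ler_wpM2l cK d3.
have := ler_wpM2l K0 d2.
lra.
Qed.

End freezing.

(** * Stochastic recursions *)

Section square_summable_steps.
Context {R : realType}.
Variables (al : nat -> R) (mu C : R).
Hypotheses (mu0 : 0 < mu) (C0 : 0 <= C) (al0 : forall k, 0 < al k).
Hypothesis al_sum : series al @ \oo --> +oo.
Hypothesis al_sum2 : cvgn (series (fun k => al k ^+ 2)).

(** What the perturbation still adds from time [k] on. *)
Definition noise_tail k : R :=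
  C * (limn (series (fun k => al k ^+ 2)) - series (fun k => al k ^+ 2) k).

Lemma noise_tail_succ k : noise_tail k.+1 + C * al k ^+ 2 = noise_tail k.
Proof. by rewrite /noise_tail seriesSr; ring. Qed.

Lemma noise_tail_ge0 k : 0 <= noise_tail k.
Proof.
rewrite mulr_ge0// subr_ge0; apply: nondecreasing_cvgn_le => //.
by apply/nondecreasing_seqP => i; rewrite seriesSr lerDl sqr_ge0.
Qed.

Lemma noise_tail_cvg0 : noise_tail k @[k --> \oo] --> 0.
Proof.
rewrite -[0](mulr0 C); apply: cvgMr.
rewrite -(subrr (limn (series (fun k => al k ^+ 2)))).
by apply: cvgB => //; exact: cvg_cst.
Qed.

(** Adding the tail of the noise makes the recursion monotone; the total decrease
    being finite while the steps sum to infinity, the sequence is small at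
    arbitrarily late times, and remains so by monotonicity. *)
Lemma stochastic_recursion_cvg0 (a : nat -> R) : (forall k, 0 <= a k) ->
  (forall k, a k.+1 <= (1 - al k * mu) * a k + C * al k ^+ 2) ->
  a k @[k --> \oo] --> 0.
Proof.
move=> a0 arec; pose W k := a k + noise_tail k.
have Wdec k : W k.+1 <= W k - mu * (al k * a k).
  by have := arec k; rewrite /W -(noise_tail_succ k); lra.
have Wmon : {homo W : m k / (m <= k)%N >-> k <= m}.
  apply/nonincreasing_seqP => k; apply: (le_trans (Wdec k)).
  by rewrite lerBlDr lerDl !mulr_ge0 ?(ltW mu0) ?(ltW (al0 _)).
have small e N : 0 < e -> exists2 k, (N <= k)%N & a k < e.
  move=> e0; apply/not_exists2P => hN.
  have {}hN k : (N <= k)%N -> e <= a k.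
    by move=> Nk; have [//|/negP] := hN k; rewrite -leNgt.
  have dec m : W (N + m)%N <= W N - mu * e * (series al (N + m)%N - series al N).
    elim: m => [|m IH]; first by rewrite addn0 subrr mulr0 subr0.
    rewrite addnS; apply: (le_trans (Wdec _)); rewrite seriesSr.
    have := hN (N + m)%N (leq_addr _ _).
    rewrite -(ler_pM2l (mulr_gt0 mu0 (al0 (N + m)%N))); lra.
  have : \forall k \near \oo, series al N + (W N + 1) / (mu * e) <= series al k.
    by move/cvgryPge : al_sum; apply.
  move=> [K _ hK]; have := hK (N + K)%N (leq_addl _ _); have := dec K => {}hK.
  have me : 0 < mu * e by exact: mulr_gt0.
  rewrite /= -lerBrDl ler_pdivrMr//.
  have : 0 <= W (N + K)%N by rewrite addr_ge0// noise_tail_ge0.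
  by move: hK; lra.
apply/cvgrPdist_le => e e0.
have e2 : 0 < e / 2 by rewrite divr_gt0.
have : \forall k \near \oo, noise_tail k <= e / 2.
  move/cvgrPdist_le : noise_tail_cvg0 => /(_ _ e2); apply: filterS => k.
  by rewrite sub0r normrN ger0_norm// noise_tail_ge0.
move=> [N _ hN]; have [k Nk ak] := small _ N e2.
exists k => // i /= ki; rewrite sub0r normrN ger0_norm//.
have := Wmon _ _ ki; have := hN _ Nk; have := noise_tail_ge0 i; rewrite /W; lra.
Qed.

End square_summable_steps.

Section maximal_inequality.
Context {R : realType} {d : measure_display} {T : measurableType d}.
Variables (P : probability T R) (G : nat -> set (set T)).
Hypothesis GT : forall k, <<s G k >> `<=` measurable.
Hypothesis Gmono : forall k, <<s G k >> `<=` <<s G k.+1 >>.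

Definition adapted (W : nat -> T -> R) :=
  forall k, measurable_fun [set: g_sigma_algebraType (G k)] (W k).

(** Ville's maximal inequality. On the event [E i] of the proof, that the level
    has not been reached before time [i], the integral of [W i] decreases with [i],
    and passing to [E i.+1] loses at least [e] times the probability lost. *)
Lemma maximal_inequality (W : nat -> T -> R) (e : R) :
  adapted W -> (forall k w, 0 <= W k w) ->
  (forall k A, <<s G k >> A ->
    (\int[P]_(w in A) (W k.+1 w)%:E <= \int[P]_(w in A) (W k w)%:E)%E) ->
  0 < e ->
  (e%:E * P (\bigcup_i [set w | (e <= W i w)%R]) <= \int[P]_w (W 0%N w)%:E)%E.
Proof.
move=> adW W0 Wdec e0.
pose E i : set T := [set w | forall l, (l < i)%N -> W l w < e].
have mW i : measurable_fun [set: T] (W i) by exact: sub_measurable_fun (adW i).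
have ES i : E i.+1 = E i `&` [set w | W i w < e].
  apply/seteqP; split=> [w h|w [h1 h2] l].
    by split=> [l li|]; apply: h => //; exact: ltnW.
  by rewrite ltnS leq_eqVlt => /orP[/eqP -> //|/h1].
have E0 : E 0%N = setT by apply/seteqP; split.
have GE i : <<s G i >> (E i) /\ <<s G i >> (E i.+1).
  elim: i => [|i [_ IH]].
    rewrite ES E0 setTI; split.
      exact: (@measurableT _ (g_sigma_algebraType _)).
    have := adW 0%N measurableT `]-oo, e[%classic (measurable_itv _).
    by rewrite setTI; congr (<<s G 0%N >> _); apply/seteqP; split => w /=;
    rewrite in_itv.
  have GEi : <<s G i.+1 >> (E i.+1) by exact: Gmono.
  split=> //; rewrite ES.
  apply: (@measurableI _ (g_sigma_algebraType (G i.+1))) => //.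
  have := adW i.+1 measurableT `]-oo, e[%classic (measurable_itv _).
  by rewrite setTI; congr (<<s G i.+1 >> _); apply/seteqP; split => w /=;
    rewrite in_itv.
have mE i : measurable (E i) by apply: GT; exact: (GE i).1.
have ind i : (e%:E * P (~` E i) + \int[P]_(w in E i) (W i w)%:E <=
    \int[P]_w (W 0%N w)%:E)%E.
  elim: i => [|i]; first by rewrite E0 setCT measure0 mule0 add0e.
  apply: le_trans.
  pose D := E i `\` E i.+1.
  have mD : measurable D by exact: measurableD.
  have EiE : E i = E i.+1 `|` D by rewrite setDUK// ES; exact: subIsetl.
  have dis : [disjoint E i.+1 & D] by apply/disj_setPS => w [? []].
  have -> : (\int[P]_(w in E i) (W i w)%:E =
      \int[P]_(w in E i.+1) (W i w)%:E + \int[P]_(w in D) (W i w)%:E)%E.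
    rewrite {1}EiE ge0_integral_setU//.
      by apply/measurable_EFinP; exact: measurable_funTS.
    by move=> w _; rewrite lee_fin.
  have -> : P (~` E i.+1) = (P (~` E i) + P D)%E.
    rewrite -measureU ?(measurableC (mE _))//.
      congr (P _); rewrite /D {1}(_ : E i.+1 = E i `&` E i.+1) ?setCI ?setDE.
        by rewrite setUIr setUCl setTI.
      by apply/esym/setIidr; rewrite ES; exact: subIsetl.
      exact: measurableC.
    by apply/seteqP; split=> // w [? []].
  rewrite ge0_muleDr//.
  rewrite -addeA leeD2l// addeC; apply: leeD; first exact: Wdec (GE i).2.
  rewrite -integralr_cst//; apply: ge0_le_integral => //.
  - by move=> w _; rewrite lee_fin ltW.
  - by apply/measurable_EFinP; exact: measurable_funTS.
  - move=> w; rewrite /D ES lee_fin => -[h1 h2]; rewrite leNgt; apply/negP => h3.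
    by apply: h2.
have cvgP : P (~` E i) @[i --> \oo] --> P (\bigcup_i ~` E i).
  apply: nondecreasing_cvg_mu.
  - by move=> i; exact: measurableC.
  - by apply: bigcupT_measurable => i; exact: measurableC.
  - by apply/nondecreasing_seqP => i; apply/subsetPset/subsetC;
      rewrite ES; exact: subIsetl.
have -> : \bigcup_i [set w | e <= W i w] = \bigcup_i ~` E i.
  apply/seteqP; split=> w [i _ /= h].
    by exists i.+1 => //= /(_ i (ltnSn i)); rewrite ltNge h.
  apply: contrapT => h'; apply: h => l _; rewrite ltNge; apply/negP => h2.
  by apply: h'; exists l.
rewrite -lee_pdivlMl//.
apply: (cvge_to_le cvgP); apply: nearW => i; rewrite lee_pdivlMl//.
apply: le_trans (ind i); rewrite leeDl//; exact: integralr_ge0.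
Qed.

End maximal_inequality.

Section almost_supermartingale.
Context {R : realType} {d : measure_display} {T : measurableType d}.
Variables (P : probability T R) (G : nat -> set (set T)).
Hypothesis GT : forall k, <<s G k >> `<=` measurable.
Hypothesis Gmono : forall k, <<s G k >> `<=` <<s G k.+1 >>.
Variables (V : nat -> T -> R) (al : nat -> R) (mu C : R).
Hypotheses (mu0 : 0 < mu) (C0 : 0 <= C) (al0 : forall k, 0 < al k).
Hypothesis al_mu : forall k, al k * mu <= 1.
Hypothesis al_sum : series al @ \oo --> +oo.
Hypothesis al_sum2 : cvgn (series (fun k => al k ^+ 2)).
Hypothesis adV : adapted G V.
Hypothesis V0 : forall k w, 0 <= V k w.
Hypothesis V0fin : (\int[P]_w (V 0%N w)%:E < +oo)%E.
Hypothesis Vrec : forall k A, <<s G k >> A ->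
  (\int[P]_(w in A) (V k.+1 w)%:E <=
   \int[P]_(w in A) ((1 - al k * mu) * V k w + C * al k ^+ 2)%:E)%E.

Let mV k : measurable_fun [set: T] (V k).
Proof. exact: (sub_measurable_fun (@GT k) (@adV k)). Qed.

Let Cal0 k : 0 <= C * al k ^+ 2.
Proof. by rewrite mulr_ge0// sqr_ge0. Qed.

Let Vrec_T k : (\int[P]_w (V k.+1 w)%:E <=
  (1 - al k * mu)%:E * \int[P]_w (V k w)%:E + (C * al k ^+ 2)%:E)%E.
Proof.
apply: (le_trans (Vrec (@measurableT _ (g_sigma_algebraType (G k))))).
have alm : 0 <= 1 - al k * mu by rewrite subr_ge0.
rewrite integralr_add//; last 2 first.
- exact: measurable_funM.
- by move=> w; rewrite mulr_ge0.
by rewrite (@integralr_scale _ _ _ P _ (V k))// leeD2l// integralr_cst_le.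
Qed.

Lemma recursion_fin_num k : (\int[P]_w (V k w)%:E < +oo)%E.
Proof.
elim: k => // k IH; apply: (le_lt_trans (Vrec_T k)).
by rewrite lte_add_pinfty ?ltry// lte_mul_pinfty// lee_fin subr_ge0.
Qed.

Let VE k : (\int[P]_w (V k w)%:E = (fine (\int[P]_w (V k w)%:E))%:E)%E.
Proof.
by rewrite fineK// ge0_fin_numE ?recursion_fin_num//; exact: integralr_ge0.
Qed.

Let fine_cvg0 : fine (\int[P]_w (V k w)%:E)%E @[k --> \oo] --> (0 : R).
Proof.
apply: (stochastic_recursion_cvg0 mu0 C0 al0 al_sum al_sum2) => k.
  by rewrite fine_ge0// integralr_ge0.
by have := Vrec_T k; rewrite (VE k) (VE k.+1) -EFinM -EFinD lee_fin.
Qed.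

Lemma recursion_cvg_mean : (\int[P]_w (V k w)%:E)%E @[k --> \oo] --> 0%E.
Proof.
under eq_fun do rewrite VE.
by apply/fine_cvgP; split => //; apply: nearW.
Qed.

(** Adding the tail of the noise turns [V] into a nonnegative supermartingale
    whose mean tends to 0; by the maximal inequality the probability that it
    exceeds a given level after time [k] tends to 0 with [k]. *)
Lemma recursion_cvg_ae : {ae P, forall w, V k w @[k --> \oo] --> (0 : R)}.
Proof.
pose W k w := V k w + noise_tail al C k.
have mW k : measurable_fun [set: T] (W k) by exact: measurable_funD.
have T0 k := noise_tail_ge0 C0 al_sum2 k.
have W0 k w : 0 <= W k w by rewrite addr_ge0.
have Wint k A : measurable A -> (\int[P]_(w in A) (W k w)%:E =
    \int[P]_(w in A) (V k w)%:E + (noise_tail al C k)%:E * P A)%E.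
  by move=> mA; rewrite integralr_add// integralr_cst.
have Wdec k A : <<s G k >> A ->
    (\int[P]_(w in A) (W k.+1 w)%:E <= \int[P]_(w in A) (W k w)%:E)%E.
  move=> GA; have mA : measurable A by exact: GT GA.
  rewrite !Wint// -(noise_tail_succ al C k) EFinD ge0_muleDl ?lee_fin//.
  rewrite (addeC (_ * P A)%E) addeA; apply: leeD => //.
  apply: (le_trans (Vrec GA)).
  rewrite -integralr_cst// -integralr_add//; apply: integralr_mono => //.
  - by apply: measurable_funD => //; exact: measurable_funM.
  - exact: measurable_funD.
  - by move=> w; rewrite addr_ge0// mulr_ge0// subr_ge0.
  - move=> w; rewrite lerD2r ler_piMl// lerBlDr lerDl mulr_ge0//; exact: ltW.
(* the level [1 / (n + 1)] is reached at arbitrarily late times *)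
pose B (n : nat) := \bigcap_k \bigcup_i [set w | n.+1%:R^-1 <= W (k + i)%N w].
have mB n : measurable (B n).
  apply: bigcapT_measurable => k; apply: bigcupT_measurable => i.
  have := mW (k + i)%N measurableT `[n.+1%:R^-1, +oo[%classic (measurable_itv _).
  by rewrite setTI; congr measurable; apply/seteqP; split => w /=;
    rewrite in_itv/= andbT.
have PB n : P (B n) = 0%E.
  have e0 : 0 < n.+1%:R^-1 :> R by rewrite invr_gt0.
  apply/eqP; rewrite eq_le measure_ge0 andbT.
  have PBk k : (P (B n) <= n.+1%:R%:E * \int[P]_w (W k w)%:E)%E.
    have adW : adapted (fun i => G (k + i)%N) (fun i => W (k + i)%N).
      by move=> i; apply: measurable_funD => //; exact: adV.
    have := @maximal_inequality R d T P (fun i => G (k + i)%N) _ _ _ _ adW _ _ e0.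
    rewrite addn0 => h; rewrite -lee_pdivrMl; last by rewrite ltr0n.
    apply: le_trans (h _ _ _ _) => [|i|i|i w|i A]; rewrite ?addnS//; last exact: Wdec.
    apply: lee_wpmul2l; first by rewrite lee_fin ltW.
    apply: le_measure; rewrite ?inE//; last by move=> w Bw; exact: Bw k I.
    apply: bigcupT_measurable => i.
    have := mW (k + i)%N measurableT `[n.+1%:R^-1, +oo[%classic (measurable_itv _).
    by rewrite setTI; congr measurable; apply/seteqP; split => w /=;
    rewrite in_itv/= andbT.
  have WE k : (\int[P]_w (W k w)%:E =
      (fine (\int[P]_w (V k w)%:E) + noise_tail al C k)%:E)%E.
    by rewrite Wint// [P _]probability_setT mule1 VE -EFinD.
  apply/lee_addgt0Pr => e e1; rewrite add0e.
  have : (fine (\int[P]_w (V k w)%:E)%E + noise_tail al C k) @[k --> \oo] --> (0 : R).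
    by rewrite -[0]addr0; apply: cvgD => //; exact: noise_tail_cvg0.
  move/cvgrPdist_le => /(_ (n.+1%:R^-1 * e) (mulr_gt0 e0 e1)) [k _ /(_ k (leqnn k))].
  rewrite sub0r normrN => hk; apply: (le_trans (PBk k)); rewrite WE -EFinM lee_fin.
  by rewrite -ler_pdivlMl ?ltr0n// (le_trans (ler_norm _)).
have neg : P.-negligible (\bigcup_n B n).
  by apply: negligible_bigcup => n; exists (B n);
    split; [exact: mB|exact: PB|exact: subset_refl].
apply: negligibleS neg => w /= nc; apply: contrapT => hB; apply: nc.
  apply/cvgrPdist_le => e e0.
  have [n _ /(_ n (leqnn n)) ne] := near_infty_natSinv_lt (PosNum e0).
  have : ~ B n w by move=> Bn; apply: hB; exists n.
  move=> /existsNP[k /not_implyP[_ hk]].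
  exists k => // l /= kl; rewrite sub0r normrN ger0_norm//.
  apply: (@le_trans _ _ (W l w)); first by rewrite lerDl.
  rewrite leNgt; apply/negP => h; apply: hk; exists (l - k)%N => //=.
  by rewrite subnKC// ltW// (lt_trans ne).
Qed.

End almost_supermartingale.

(** * The iterates and the history of the method *)

Section run.
Context {R : realType} {J : nat} {n : 'I_J -> nat}
  {dA : 'I_J -> measure_display} {A : forall j, measurableType (dA j)}
  {dO : measure_display} {Omega : measurableType dO}.
Unset Implicit Arguments.
Variables (P : probability Omega R)
  (Y : forall j, set 'rV[R]_(n j))
  (g : forall j, A j -> 'rV[R]_(n j) -> R)
  (F : 'rV[R]_(\sum_j n j) -> 'rV[R]_(\sum_j n j))
  (alpha : nat -> R) (beta : R) (N : nat -> 'I_J -> nat)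
  (d0 : forall j, 'rV[R]_(n j))
  (omega : nat -> forall j, nat -> Omega -> A j)
  (d z : nat -> forall j, nat -> Omega -> 'rV[R]_(n j))
  (x u v : nat -> Omega -> 'rV[R]_(\sum_j n j))
  (Mg L mu c : R) (xs : 'rV[R]_(\sum_j n j)).
Hypotheses (hbeta : 0 < beta < 2)
  (hN : forall k j, (1 <= k)%N -> (1 <= N k j)%N)
  (hg_meas : forall j (y : 'rV[R]_(n j)),
     measurable_fun [set: A j] (fun a => g j a y))
  (homega : forall k j i, (1 <= k)%N -> (1 <= i <= N k j)%N ->
     measurable_fun [set: Omega] (omega k j i))
  (hd : forall k j i, (1 <= k)%N -> (1 <= i <= N k j)%N ->
     random_vector (d k j i))
  (hx0 : random_vector (x 0%N))
  (hx0E : forall j,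
     (\int[P]_w (enorm (submxrow (x 0%N w) j) ^+ 2)%:E < +oo)%E)
  (hrun : korpelevich_run Y g F alpha beta N d0 omega d z x u v)
  (hYclosed : forall j, closed (Y j))
  (hYconvex : forall j, convex_set (Y j))
  (hS : forall j, feasible_set g Y j !=set0)
  (hgconvex : forall j (a : A j),
     convex_function [set: 'rV[R]_(n j)] (g j a))
  (hMg : 0 < Mg)
  (hsubgrad : forall j (a : A j) (y e : 'rV[R]_(n j)),
     Y j y -> subdifferential (g j a) y e -> enorm e <= Mg)
  (hL : 0 < L)
  (hF_lip : forall y y', block_prod Y y -> block_prod Y y' ->
     enorm (F y - F y') <= L * enorm (y - y'))
  (hmu : 0 < mu)
  (hF_mono : forall y y', block_prod Y y -> block_prod Y y' ->
     mu * enorm (y - y') ^+ 2 <= dot (F y - F y') (y - y'))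
  (hc : 0 < c)
  (hsampling : sampling_regularity P Y g N omega d (x 0%N) c)
  (halpha_gt0 : forall k, 0 < alpha k)
  (halpha_sum : series alpha @ \oo --> +oo)
  (halpha_sum2 : cvgn (series (fun k => alpha k ^+ 2)))
  (halpha_le : forall k, alpha k <= 1 / (4 * (L + mu)))
  (hxs : VI_solution (block_prod (feasible_set g Y)) F xs).
Set Implicit Arguments.

Let Y0 j : Y j !=set0.
Proof. by have [s [_ Ys]] := hS j; exists s. Qed.

Lemma run_mem k w : block_prod Y (u k.+1 w) /\ block_prod Y (v k.+1 w).
Proof.
split=> j /=; first by rewrite (run_u hrun); exact: proj_in.
by rewrite (run_v hrun); exact: proj_in.
Qed.

Lemma run_z_mem k j i w : (i <= N k.+1 j)%N -> Y j (z k.+1 j i w).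
Proof.
case: i => [_|i iN]; last by rewrite (run_z hrun)//; exact: proj_in.
by rewrite (run_z0 hrun); exact: (run_mem k w).2.
Qed.

Lemma run_x_mem k w : block_prod Y (x k w).
Proof.
case: k => [|k]; first exact: (run_init hrun).
by move=> j /=; rewrite (run_x hrun); exact: run_z_mem.
Qed.

(** * Measurability with respect to the history *)

(** The generators of the history, isolated so that the history becomes the
    sigma-algebra of a measurable type. *)
Definition history_gen k : set (set Omega) :=
  [set E | exists i (B : set R),
         measurable B /\ E = (fun w => x 0%N w 0 i) @^-1` B] `|`
      [set E | exists l j i (B : set (A j)),
         [/\ (1 <= l <= k)%N, (1 <= i <= N l j)%N, measurable B &
             E = omega l j i @^-1` B]] `|`
      [set E | exists l j i t (B : set R),
         [/\ (1 <= l <= k)%N, (1 <= i <= N l j)%N, measurable B &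
             E = (fun w => d l j i w 0 t) @^-1` B]].

Local Notation hist k := (g_sigma_algebraType (history_gen k)).

Lemma history_measurable k : <<s history_gen k >> `<=` measurable.
Proof.
apply: smallest_sub; first exact: sigma_algebra_measurable.
move=> E [[[i [B [mB ->]]]|[l [j [i [B [/andP[l1 _] iN mB ->]]]]]]|].
- by rewrite -[_ @^-1` _]setTI; exact: hx0.
- by rewrite -[_ @^-1` _]setTI; exact: homega.
- move=> [l [j [i [t [B [/andP[l1 _] iN mB ->]]]]]].
  by rewrite -[_ @^-1` _]setTI; exact: hd.
Qed.

Lemma history_mono k : <<s history_gen k >> `<=` <<s history_gen k.+1 >>.
Proof.
apply: smallest_sub; first exact: smallest_sigma_algebra.
move=> E hE; apply: sub_sigma_algebra.
case: hE => [[h0|[l [j [i [B [/andP[l1 lk] iN mB ->]]]]]]|].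
- by left; left.
- by left; right; exists l, j, i, B; split; rewrite // l1 leqW.
- move=> [l [j [i [t [B [/andP[l1 lk] iN mB ->]]]]]].
  by right; exists l, j, i, t, B; split; rewrite // l1 leqW.
Qed.

Lemma random_vector_history m (X : Omega -> 'rV[R]_m) k :
  random_vector (X : hist k -> _) -> random_vector (X : hist k.+1 -> _).
Proof.
move=> mX i _ B mB; rewrite setTI; apply: history_mono.
by have := mX i measurableT B mB; rewrite setTI.
Qed.

Lemma omega_history k j i : (1 <= i <= N k.+1 j)%N ->
  measurable_fun [set: hist k.+1] (omega k.+1 j i).
Proof.
move=> iN _ B mB; rewrite setTI; apply: sub_sigma_algebra.
by left; right; exists k.+1, j, i, B; split; rewrite ?leqnn.
Qed.

Lemma d_history k j i : (1 <= i <= N k.+1 j)%N ->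
  random_vector (d k.+1 j i : hist k.+1 -> _).
Proof.
move=> iN t _ B mB; rewrite setTI; apply: sub_sigma_algebra.
by right; exists k.+1, j, i, t, B; split; rewrite ?leqnn.
Qed.

Lemma x0_history : random_vector (x 0%N : hist 0%N -> _).
Proof.
move=> i _ B mB; rewrite setTI; apply: sub_sigma_algebra.
by left; left; exists i, B.
Qed.

Lemma random_vector_F d' (T : measurableType d')
    (X : T -> 'rV[R]_(\sum_j n j)) :
  random_vector X -> (forall w, block_prod Y (X w)) ->
  random_vector (fun w => F (X w)).
Proof.
move=> mX YX i.
apply: (@measurable_lipschitz_comp _ _ _ _ (block_prod Y) X
  (fun _ y => F y 0 i) L) => // w y y' Yy Yy'.
apply: le_trans (hF_lip _ _ Yy Yy').
by have := normr_coord_le_enorm (F y - F y') i; rewrite !mxE.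
Qed.

Lemma pos_part_g_lipschitz j a (y y' : 'rV[R]_(n j)) : Y j y -> Y j y' ->
  `|pos_part (g j a) y - pos_part (g j a) y'| <= Mg * enorm (y - y').
Proof.
by apply: pos_part_lipschitz => // y1 e; exact: hsubgrad.
Qed.

Lemma measurable_pos_part d' (T : measurableType d') j (om : T -> A j) y :
  measurable_fun setT om ->
  measurable_fun setT (fun w => pos_part (g j (om w)) y).
Proof.
move=> mom; apply: measurable_maxr => //.
exact: (measurableT_comp (hg_meas j y)).
Qed.

(** The projections and [F] are Lipschitz on the sets where they are evaluated, so
    that measurability passes from [x k] to [u k.+1] and then to [v k.+1]. *)
Lemma v_history_of_x k : random_vector (x k : hist k -> _) ->
  random_vector (v k.+1 : hist k -> _).
Proof.
move=> mx.
have mstep (y : hist k -> 'rV[R]_(\sum_j n j)) (X : hist k -> _) :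
    (forall w j, submxrow (y w) j =
      proj (Y j) (submxrow (x k w) j - alpha k *: submxrow (F (X w)) j)) ->
    random_vector X -> (forall w, block_prod Y (X w)) -> random_vector y.
  move=> yE mX YX; apply: random_vector_blocks => j.
  under eq_fun do rewrite yE.
  apply: random_vector_proj => //; apply: random_vectorB.
    exact: random_vector_submxrow.
  apply: random_vectorZ => //; apply: random_vector_submxrow.
  exact: random_vector_F.
apply: (mstep _ (u k.+1)) => [w j||w]; first exact: (run_v hrun).
  apply: (mstep _ (x k)) => // [w j|w]; first exact: (run_u hrun).
  exact: run_x_mem.
exact: (run_mem k w).1.
Qed.

(** Along the feasibility steps, the violation is Lipschitz in the current point and
    measurable in the sample, and the directions belong to the history. *)
Lemma x_history k : random_vector (x k : hist k -> _).
Proof.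
elim: k => [|k IH]; first exact: x0_history.
have mv := random_vector_history (v_history_of_x IH).
apply: random_vector_blocks => j.
under eq_fun do rewrite (run_x hrun).
suff mz i : (i <= N k.+1 j)%N -> random_vector (z k.+1 j i : hist k.+1 -> _).
  exact: mz.
elim: i => [_|i IHi iN].
  rewrite (_ : z k.+1 j 0%N = fun w => submxrow (v k.+1 w) j).
    exact: random_vector_submxrow.
  by apply/funext => w; rewrite (run_z0 hrun).
rewrite (_ : z k.+1 j i.+1 = fun w => proj (Y j) (z k.+1 j i w -
    (beta * (pos_part (g j (omega k.+1 j i.+1 w)) (z k.+1 j i w) /
       enorm (d k.+1 j i.+1 w) ^+ 2)) *: d k.+1 j i.+1 w)); last first.
  by apply/funext => w; rewrite (run_z hrun).
have {}IHi := IHi (ltnW iN).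
have md : random_vector (d k.+1 j i.+1 : hist k.+1 -> _) by exact: d_history.
apply: random_vector_proj => //; apply: random_vectorB => //.
apply: random_vectorZ => //; apply: measurable_funM => //.
apply: measurable_funM.
  apply: (@measurable_lipschitz_comp R _ (hist k.+1) _ (Y j) (z k.+1 j i)
    (fun w y => pos_part (g j (omega k.+1 j i.+1 w)) y) Mg) => //.
  - by move=> w; apply: run_z_mem; exact: ltnW.
  - by move=> y _; apply: measurable_pos_part; exact: omega_history.
  - by move=> w y y'; exact: pos_part_g_lipschitz.
apply: measurable_inv; first by move=> w; rewrite sqr_ge0.
exact: measurable_enorm_sqr.
Qed.

Lemma v_history k : random_vector (v k.+1 : hist k -> _).
Proof. exact: v_history_of_x (@x_history k). Qed.

Let rv_hist m (X : Omega -> 'rV[R]_m) k :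
  random_vector (X : hist k -> _) -> random_vector X.
Proof. by move=> mX i; exact: (sub_measurable_fun (@history_measurable k) (mX i)). Qed.

Lemma x_measurable k : random_vector (x k).
Proof. exact: rv_hist (@x_history k). Qed.

Lemma v_measurable k : random_vector (v k.+1).
Proof. exact: rv_hist (@v_history k). Qed.

(** * The recursion for the mean squared error *)

Let V k w := enorm (x k w - xs) ^+ 2.
Let gam := beta * (2 - beta) / Mg ^+ 2.
Let B := enorm (F xs).
(* the constant of [korpelevich_step_dist] for [q := gam / c], the multiple of the
   squared distances that the feasibility steps recover on average *)
Let C := 2 * B ^+ 2 + B ^+ 2 / (gam / c).
Let gp k j w :=
  pos_part (g j (omega k.+1 j 1%N w)) (submxrow (v k.+1 w) j).

Let gam0 : 0 < gam.
Proof. by rewrite divr_gt0 ?exprn_gt0//; move: hbeta => /andP[? ?]; nra. Qed.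

Let gc0 : 0 < gam / c. Proof. exact: divr_gt0. Qed.

Let C0 : 0 <= C.
Proof.
apply: addr_ge0; first by apply: mulr_ge0; [|exact: sqr_ge0].
by apply: divr_ge0; [exact: sqr_ge0|exact: ltW].
Qed.

Let alm k : alpha k * mu <= 1.
Proof.
have := step_size_small hL hmu (halpha_le k).
by have := mulr_gt0 (halpha_gt0 k) hL; lra.
Qed.

Let SY j : feasible_set g Y j `<=` Y j.
Proof. by move=> y []. Qed.

Let xs_feasible j : feasible_set g Y j (submxrow xs j).
Proof. exact: hxs.1. Qed.

(** Only the gain of the first feasibility step is kept. Its starting point [v] is
    determined by the history before the iteration, to which the sampling
    condition refers; the later steps do not increase the distance to [xs]. *)
Lemma run_block_decrease k j w :
  enorm (submxrow (x k.+1 w) j - submxrow xs j) ^+ 2 + gam * gp k j w ^+ 2 <=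
  enorm (submxrow (v k.+1 w) j - submxrow xs j) ^+ 2.
Proof.
have [gxs Yxs] := xs_feasible j.
have step i : (i < N k.+1 j)%N ->
    enorm (z k.+1 j i.+1 w - submxrow xs j) ^+ 2 <=
    enorm (z k.+1 j i w - submxrow xs j) ^+ 2 -
      gam * pos_part (g j (omega k.+1 j i.+1 w)) (z k.+1 j i w) ^+ 2.
  move=> iN; rewrite (run_z hrun)//.
  apply: (feasibility_step (e := d0 j)) => //.
  - by move=> y e; exact: hsubgrad.
  - exact: run_z_mem (ltnW iN).
  - exact: gxs.
  - exact: (run_d hrun).
have N1 : (0 < N k.+1 j)%N by exact: hN.
rewrite -lerBrDr (run_x hrun).
suff later i : (0 < i <= N k.+1 j)%N ->
    enorm (z k.+1 j i w - submxrow xs j) ^+ 2 <=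
    enorm (submxrow (v k.+1 w) j - submxrow xs j) ^+ 2 - gam * gp k j w ^+ 2.
  by apply: later; rewrite N1 leqnn.
elim: i => // -[_ _|i IH /andP[_ iN]].
  by have := step 0%N N1; rewrite (run_z0 hrun).
apply: le_trans (IH (ltnW iN)).
apply: (le_trans (step _ iN)); rewrite lerBlDr lerDl.
by rewrite mulr_ge0 ?sqr_ge0 ?(ltW gam0).
Qed.

Lemma run_decrease k w :
  V k.+1 w + gam * \sum_j gp k j w ^+ 2 <= enorm (v k.+1 w - xs) ^+ 2.
Proof.
rewrite /V !enorm_sqr_blocks mulr_sumr -big_split/=; apply: ler_sum => j _.
by rewrite !submxrowB run_block_decrease.
Qed.

Lemma run_step k w : enorm (v k.+1 w - xs) ^+ 2 <=
  (1 - alpha k * mu) * V k w + C * alpha k ^+ 2 +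
  gam / c * \sum_j dist (submxrow (v k.+1 w) j) (feasible_set g Y j) ^+ 2.
Proof.
apply: (@korpelevich_step_dist R J n Y (feasible_set g Y) F L mu (alpha k)
  (x k w) (u k.+1 w)) => //.
- exact: run_x_mem.
- exact: (run_u hrun).
- exact: (run_v hrun).
Qed.

Lemma run_bound k w :
  enorm (v k.+1 w - xs) ^+ 2 <= 2 * V k w + 8 * B ^+ 2 * alpha k ^+ 2.
Proof.
apply: (@korpelevich_step_bound R J n Y (feasible_set g Y) F L mu (alpha k)
  (x k w) (u k.+1 w)) => //.
- exact: run_x_mem.
- exact: (run_u hrun).
- exact: (run_v hrun).
Qed.

Let V0 k w : 0 <= V k w. Proof. exact: sqr_ge0. Qed.

Let mV k : measurable_fun [set: Omega] (V k).
Proof.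
apply: measurable_enorm_sqr; apply: random_vectorB; first exact: x_measurable.
exact: random_vector_cst.
Qed.

Let mv2 k : measurable_fun [set: Omega] (fun w => enorm (v k.+1 w - xs) ^+ 2).
Proof.
apply: measurable_enorm_sqr; apply: random_vectorB; first exact: v_measurable.
exact: random_vector_cst.
Qed.

Let mgp k j : measurable_fun [set: Omega] (gp k j).
Proof.
apply: (@measurable_lipschitz_comp _ _ _ _ (Y j) (fun w => submxrow (v k.+1 w) j)
    (fun w y => pos_part (g j (omega k.+1 j 1%N w)) y) Mg).
- by apply: random_vector_submxrow; exact: v_measurable.
- by move=> w; exact: (run_mem k w).2.
- by move=> y _; apply: measurable_pos_part; apply: homega => //; rewrite hN.
- by move=> w y y'; exact: pos_part_g_lipschitz.
Qed.

Let mdist k j : measurable_fun [set: Omega]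
  (fun w => dist (submxrow (v k.+1 w) j) (feasible_set g Y j)).
Proof.
apply: (@measurable_lipschitz_comp _ _ _ _ setT (fun w => submxrow (v k.+1 w) j)
    (fun _ y => dist y (feasible_set g Y j)) 1) => //.
- by apply: random_vector_submxrow; exact: v_measurable.
- by move=> w y y' _ _; rewrite mul1r dist_lip_norm.
Qed.

(** The sampling condition, known for fixed points only, at the random point [v]. *)
Lemma sampling_block k j E : <<s history_gen k >> E ->
  (\int[P]_(w in E)
     (dist (submxrow (v k.+1 w) j) (feasible_set g Y j) ^+ 2)%:E <=
   c%:E * \int[P]_(w in E) (gp k j w ^+ 2)%:E)%E.
Proof.
move=> hE.
apply: (@freezing R dO Omega (n j) P (history_gen k) (@history_measurable k) (Y j)
  (fun w => submxrow (v k.+1 w) j) (fun y => dist y (feasible_set g Y j))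
  (fun w y => pos_part (g j (omega k.+1 j 1%N w)) y) c 1 Mg) => //.
- exact: ltW.
- by apply: random_vector_submxrow; exact: v_history.
- by move=> w; exact: (run_mem k w).2.
- by move=> y; exact: dist_ge0.
- by move=> w y; exact: pos_part_ge0.
- by move=> y _; apply: measurable_pos_part; apply: homega => //; rewrite hN.
- by move=> y y' _ _; rewrite mul1r dist_lip_norm.
- by move=> w y y'; exact: pos_part_g_lipschitz.
- move=> {}E y {}hE Yy; have mE : measurable E by exact: history_measurable hE.
  have N1 : (1 <= 1 <= N k.+1 j)%N by rewrite hN.
  have [h [h0 hm hint] hle] := hsampling k j 1%N y N1 Yy.
  have mh : measurable_fun [set: Omega] h.
    by move=> _ D mD; rewrite setTI; apply: (@history_measurable k); exact: hm.
  rewrite -hint// -ge0_integralZl_EFin//; last 2 first.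
  + exact: measurable_funTS.
  + exact: ltW.
  apply: ae_ge0_le_integral => //.
  + by move=> w _; rewrite lee_fin sqr_ge0.
  + by move=> w _; rewrite mule_ge0// lee_fin ltW.
  + by apply: measurable_funeM; exact: measurable_funTS.
  + by apply: filterS hle => w.
Qed.

Let v_fin k : (\int[P]_w (V k w)%:E < +oo)%E ->
  (\int[P]_w (enorm (v k.+1 w - xs) ^+ 2)%:E < +oo)%E.
Proof.
move=> Vfin.
have c0 : 0 <= 8 * B ^+ 2 * alpha k ^+ 2.
  by apply: mulr_ge0; [apply: mulr_ge0; rewrite ?sqr_ge0|exact: sqr_ge0].
apply: (@le_lt_trans _ _ (\int[P]_w (2 * V k w + 8 * B ^+ 2 * alpha k ^+ 2)%:E)%E).
  apply: integralr_mono => //; last by move=> w; exact: run_bound.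
  - by apply: measurable_funD => //; exact: measurable_funM.
  - by move=> w; exact: sqr_ge0.
rewrite integralr_add//; last 2 first.
- exact: measurable_funM.
- by move=> w; rewrite mulr_ge0.
rewrite integralr_scale// lte_add_pinfty ?lte_mul_pinfty//.
by rewrite (le_lt_trans (integralr_cst_le _ _ _))// ltry.
Qed.

Lemma mean_sqr_fin k : (\int[P]_w (V k w)%:E < +oo)%E.
Proof.
have mx0 j : measurable_fun [set: Omega] (fun w => enorm (submxrow (x 0%N w) j) ^+ 2).
  by apply: measurable_enorm_sqr; apply: random_vector_submxrow; exact: hx0.
elim: k => [|k IH].
  apply: (@le_lt_trans _ _ (\int[P]_w (2 *
      (\sum_j enorm (submxrow (x 0%N w) j) ^+ 2) + 2 * enorm xs ^+ 2)%:E)%E).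
    apply: integralr_mono => //.
      by apply: measurable_funD => //; apply: measurable_funM => //; exact: measurable_sum.
    move=> w; rewrite -enorm_sqr_blocks /V.
    have := enormD (x 0%N w) (- xs); rewrite enormN => le1.
    have : enorm (x 0%N w - xs) ^+ 2 <= (enorm (x 0%N w) + enorm xs) ^+ 2.
      by rewrite ler_sqr ?nnegrE ?addr_ge0 ?enorm_ge0.
    have := sqr_ge0 (enorm (x 0%N w) - enorm xs); lra.
  have s0 w : 0 <= \sum_j enorm (submxrow (x 0%N w) j) ^+ 2.
    by apply: sumr_ge0 => j _; exact: sqr_ge0.
  have c0 : 0 <= 2 * enorm xs ^+ 2 by rewrite mulr_ge0 ?sqr_ge0.
  have ms := measurable_sum (index_enum 'I_J) mx0.
  rewrite integralr_add//; last 2 first.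
  - exact: measurable_funM.
  - by move=> w; rewrite mulr_ge0.
  rewrite integralr_scale// lte_add_pinfty//.
    rewrite lte_mul_pinfty// integralr_sum//; last by move=> j w; exact: sqr_ge0.
    by apply: lte_sum_pinfty => j _; exact: hx0E.
  by rewrite (le_lt_trans (integralr_cst_le _ _ _))// ltry.
apply: le_lt_trans (v_fin IH); apply: integralr_mono => // w.
apply: le_trans (run_decrease k w).
by rewrite lerDl mulr_ge0 ?(ltW gam0)// sumr_ge0// => j _; exact: sqr_ge0.
Qed.

Lemma mean_sqr_v_fin k : (\int[P]_w (enorm (v k.+1 w - xs) ^+ 2)%:E < +oo)%E.
Proof. exact: v_fin (mean_sqr_fin k). Qed.

(** On each event of the history, the expected gain of the feasibility steps pays
    for the squared distances of [run_step]; both are finite, so they cancel. *)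
Lemma mean_sqr_recursion k E : <<s history_gen k >> E ->
  (\int[P]_(w in E) (V k.+1 w)%:E <=
   \int[P]_(w in E) ((1 - alpha k * mu) * V k w + C * alpha k ^+ 2)%:E)%E.
Proof.
move=> hE; have mE : measurable E by exact: history_measurable hE.
pose GP w := gam * \sum_j gp k j w ^+ 2.
pose D w := \sum_j dist (submxrow (v k.+1 w) j) (feasible_set g Y j) ^+ 2.
pose rhs w := (1 - alpha k * mu) * V k w + C * alpha k ^+ 2.
have mgp2 j : measurable_fun [set: Omega] (fun w => gp k j w ^+ 2).
  exact: measurable_funX.
have mdist2 j : measurable_fun [set: Omega]
    (fun w => dist (submxrow (v k.+1 w) j) (feasible_set g Y j) ^+ 2).
  exact: measurable_funX.
have msgp := measurable_sum (index_enum 'I_J) mgp2.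
have mGP : measurable_fun [set: Omega] GP by exact: measurable_funM.
have mD : measurable_fun [set: Omega] D by exact: measurable_sum.
have mrhs : measurable_fun [set: Omega] rhs.
  by apply: measurable_funD => //; exact: measurable_funM.
have sgp0 w : 0 <= \sum_j gp k j w ^+ 2.
  by apply: sumr_ge0 => j _; exact: sqr_ge0.
have GP0 w : 0 <= GP w by rewrite mulr_ge0 ?(ltW gam0).
have D0 w : 0 <= D w by apply: sumr_ge0 => j _; exact: sqr_ge0.
have rhs0 w : 0 <= rhs w.
  apply: addr_ge0; first by rewrite mulr_ge0// subr_ge0.
  by apply: mulr_ge0; last exact: sqr_ge0.
have GPfin : (\int[P]_(w in E) (GP w)%:E)%E \is a fin_num.
  rewrite ge0_fin_numE; last exact: integralr_ge0.
  apply: le_lt_trans (mean_sqr_v_fin k).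
  apply: (le_trans (integralr_subset P mE mGP GP0)).
  apply: integralr_mono => // w; apply: le_trans (run_decrease k w).
  by rewrite lerDr.
rewrite -(leeD2rE _ _ GPfin) -integralr_add//.
apply: (@le_trans _ _ (\int[P]_(w in E) (rhs w + gam / c * D w)%:E)%E).
  apply: integralr_mono => //.
  - exact: measurable_funD.
  - by apply: measurable_funD => //; exact: measurable_funM.
  - by move=> w; rewrite addr_ge0.
  - by move=> w; exact: le_trans (run_decrease k w) (run_step k w).
rewrite integralr_add//; last 2 first.
- exact: measurable_funM.
- by move=> w; rewrite mulr_ge0// ltW.
apply: leeD => //; rewrite !integralr_scale ?(ltW gc0) ?(ltW gam0)//.
rewrite !integralr_sum//; last 2 first.
- by move=> j w; exact: sqr_ge0.
- by move=> j w; exact: sqr_ge0.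
apply: (@le_trans _ _ ((gam / c)%:E * (c%:E * \sum_j \int[P]_(w in E) (gp k j w ^+ 2)%:E))%E).
  apply: lee_wpmul2l; first by rewrite lee_fin ltW.
  rewrite ge0_sume_distrr; last by move=> j _; apply: integralr_ge0 => w; exact: sqr_ge0.
  by apply: lee_sum => j _; exact: sampling_block.
by rewrite muleA -EFinM divfK// gt_eqF.
Qed.

(** * Convergence *)

Let al_sum2_cvg0 : alpha k ^+ 2 @[k --> \oo] --> (0 : R).
Proof. exact: cvg_series_cvg_0. Qed.

Let adV : adapted history_gen V.
Proof.
move=> k; apply: measurable_enorm_sqr; apply: random_vectorB.
  exact: x_history.
exact: random_vector_cst.
Qed.

Lemma mean_sqr_error_cvg0 : (\int[P]_w (V k w)%:E)%E @[k --> \oo] --> 0%E.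
Proof.
exact: (recursion_cvg_mean history_measurable hmu C0 halpha_gt0 alm
  halpha_sum halpha_sum2 adV V0 (mean_sqr_fin 0) mean_sqr_recursion).
Qed.

Lemma sqr_error_cvg0_ae : {ae P, forall w, V k w @[k --> \oo] --> (0 : R)}.
Proof.
exact: (recursion_cvg_ae history_measurable history_mono hmu C0 halpha_gt0 alm
  halpha_sum halpha_sum2 adV V0 (mean_sqr_fin 0) mean_sqr_recursion).
Qed.

Lemma mean_sqr_error_v_cvg0 :
  (\int[P]_w (enorm (v k.+1 w - xs) ^+ 2)%:E)%E @[k --> \oo] --> 0%E.
Proof.
apply: (@squeeze_cvge _ _ _ _ (fun=> 0%E) _
  (fun k => (2%:E * \int[P]_w (V k w)%:E + (8 * B ^+ 2 * alpha k ^+ 2)%:E)%E)).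
- apply: nearW => k; apply/andP; split.
    by apply: integralr_ge0 => w; exact: sqr_ge0.
  have c0 : 0 <= 8 * B ^+ 2 * alpha k ^+ 2.
    by apply: mulr_ge0; [apply: mulr_ge0; rewrite ?sqr_ge0|exact: sqr_ge0].
  have m2V : measurable_fun [set: Omega] (fun w => 2 * V k w).
    exact: measurable_funM.
  apply: (@le_trans _ _ (\int[P]_w (2 * V k w + 8 * B ^+ 2 * alpha k ^+ 2)%:E)%E).
    apply: integralr_mono => //; last by move=> w; exact: run_bound.
    - exact: measurable_funD.
    - by move=> w; exact: sqr_ge0.
  rewrite integralr_add//; last by move=> w; rewrite mulr_ge0.
  by rewrite integralr_scale//; apply: leeD => //; exact: integralr_cst_le.
- exact: cvg_cst.
- have -> : 0%E = (2%:E * 0 + (8 * B ^+ 2 * 0)%:E :> \bar R)%E.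
    by rewrite mule0 mulr0 adde0.
  apply: cvgeD => //.
    by apply: cvgeZl => //; exact: mean_sqr_error_cvg0.
  by apply: cvg_EFin; [exact: nearW|apply: cvgMr].
Qed.

Lemma enorm_cvg0_ae : {ae P, forall w,
  enorm (x k w - xs) @[k --> \oo] --> (0 : R) /\
  enorm (v k w - xs) @[k --> \oo] --> (0 : R)}.
Proof.
apply: filterS sqr_error_cvg0_ae => w hV; split.
  by apply: cvg0_of_sqr => // k; exact: enorm_ge0.
rewrite -cvg_shiftS; apply: cvg0_of_sqr => [k|]; first exact: enorm_ge0.
apply: (@squeeze_cvgr _ _ _ _ (fun=> 0) (fun k => 2 * V k w + 8 * B ^+ 2 * alpha k ^+ 2)).
- by apply: nearW => k; rewrite sqr_ge0 run_bound.
- exact: cvg_cst.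
- have -> : (0 : R) = 2 * 0 + 8 * B ^+ 2 * 0 by rewrite !mulr0 addr0.
  by apply: cvgD; apply: cvgMr.
Qed.

Let S := block_prod (feasible_set g Y).

Let S0 : S !=set0. Proof. by exists xs; exact: hxs.1. Qed.

Lemma run_convergence :
  [/\ forall k w, block_prod Y (v k.+1 w) /\ block_prod Y (x k w),
      {ae P, forall w, v ^~ w @ \oo --> xs},
      {ae P, forall w, x ^~ w @ \oo --> xs},
      ('E_P[(fun w => enorm (v k w - xs))%R])%E @[k --> \oo] --> 0%E
    & ('E_P[(fun w => enorm (x k w - xs))%R])%E @[k --> \oo] --> 0%E] /\
  {ae P, forall w, dist (x k w) S @[k --> \oo] --> (0 : R)} /\
  ('E_P[(fun w => dist (x k w) S)%R])%E @[k --> \oo] --> 0%E.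
Proof.
have mx k : measurable_fun [set: Omega] (fun w => enorm (x k w - xs)).
  apply: measurable_enorm; apply: random_vectorB; first exact: x_measurable.
  exact: random_vector_cst.
have mv k : measurable_fun [set: Omega] (fun w => enorm (v k.+1 w - xs)).
  apply: measurable_enorm; apply: random_vectorB; first exact: v_measurable.
  exact: random_vector_cst.
have hE : ('E_P[(fun w => enorm (x k w - xs))%R])%E @[k --> \oo] --> 0%E.
  apply: (@mean_cvg0_of_sqr _ _ _ P (fun k w => enorm (x k w - xs))) => // [k w|].
    exact: enorm_ge0.
  exact: mean_sqr_error_cvg0.
have hdist k w : 0 <= dist (x k w) S <= enorm (x k w - xs).
  by rewrite dist_ge0// dist_le//; exact: hxs.1.
split; first split => //.
- by move=> k w; split; [exact: (run_mem k w).2|exact: run_x_mem].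
- by apply: filterS enorm_cvg0_ae => w [_ h]; exact: cvg_enorm.
- by apply: filterS enorm_cvg0_ae => w [h _]; exact: cvg_enorm.
- rewrite -cvg_shiftS.
  apply: (@mean_cvg0_of_sqr _ _ _ P (fun k w => enorm (v k.+1 w - xs))) => // [k w|].
    exact: enorm_ge0.
  exact: mean_sqr_error_v_cvg0.
split.
  apply: filterS enorm_cvg0_ae => w [h _].
  apply: (@squeeze_cvgr _ _ _ _ (fun=> 0) (fun k => enorm (x k w - xs))) => //.
    by apply: nearW => k; exact: hdist.
  exact: cvg_cst.
apply: (@squeeze_cvge _ _ _ _ (fun=> 0%E) _ _ _ _ (cvg_cst _) hE).
apply: nearW => k; rewrite unlock; apply/andP; split.
  by apply: integralr_ge0 => w; have /andP[] := hdist k w.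
apply: integralr_mono => // [|w|w]; last 2 first.
- by have /andP[] := hdist k w.
- by have /andP[] := hdist k w.
apply: (@measurable_lipschitz_comp _ _ _ _ setT (x k) (fun _ y => dist y S) 1) => //.
- exact: x_measurable.
- by move=> w y y' _ _; rewrite mul1r dist_lip_norm.
Qed.

End run.

Theorem theorem5p2 (R : realType) (J : nat) (hJ : (1 <= J)%N)
  (n : 'I_J -> nat)
  (dA : 'I_J -> measure_display) (A : forall j, measurableType (dA j))
  (dO : measure_display) (Omega : measurableType dO) (P : probability Omega R)
  (Y : forall j, set 'rV[R]_(n j))
  (g : forall j, A j -> 'rV[R]_(n j) -> R)
  (F : 'rV[R]_(\sum_j n j) -> 'rV[R]_(\sum_j n j))
  (alpha : nat -> R) (beta : R) (N : nat -> 'I_J -> nat)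
  (d0 : forall j, 'rV[R]_(n j))
  (omega : nat -> forall j, nat -> Omega -> A j)
  (d z : nat -> forall j, nat -> Omega -> 'rV[R]_(n j))
  (x u v : nat -> Omega -> 'rV[R]_(\sum_j n j))
  (Mg L mu c q : R) (zeta : nat -> R)
  (xs : 'rV[R]_(\sum_j n j))
  (* the method *)
  (hbeta : 0 < beta < 2)
  (hN : forall k j, (1 <= k)%N -> (1 <= N k j)%N)
  (hd0 : forall j, d0 j != 0)
  (hg_meas : forall j (y : 'rV[R]_(n j)),
     measurable_fun [set: A j] (fun a => g j a y))
  (homega : forall k j i, (1 <= k)%N -> (1 <= i <= N k j)%N ->
     measurable_fun [set: Omega] (omega k j i))
  (hd : forall k j i, (1 <= k)%N -> (1 <= i <= N k j)%N ->
     random_vector (d k j i))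
  (hx0 : random_vector (x 0%N))
  (hx0E : forall j, ('E_P[(fun w => enorm (submxrow (x 0%N w) j) ^+ 2)%R] < +oo)%E)
  (hrun : korpelevich_run Y g F alpha beta N d0 omega d z x u v)
  (* (a) *)
  (hYclosed : forall j, closed (Y j))
  (hYconvex : forall j, convex_set (Y j))
  (hS : forall j, feasible_set g Y j !=set0)
  (hgconvex : forall j (a : A j),
     convex_function [set: 'rV[R]_(n j)] (g j a))
  (* (b) *)
  (hMg : 0 < Mg)
  (hsubgrad : forall j (a : A j) (y e : 'rV[R]_(n j)),
     Y j y -> subdifferential (g j a) y e -> enorm e <= Mg)
  (* (c) *)
  (hL : 0 < L)
  (hF_lip : forall y y', block_prod Y y -> block_prod Y y' ->
     enorm (F y - F y') <= L * enorm (y - y'))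
  (* (d) *)
  (hmu : 0 < mu)
  (hF_mono : forall y y', block_prod Y y -> block_prod Y y' ->
     mu * enorm (y - y') ^+ 2 <= dot (F y - F y') (y - y'))
  (* (e) *)
  (hc : 0 < c)
  (hsampling : sampling_regularity P Y g N omega d (x 0%N) c)
  (* (f) *)
  (halpha_gt0 : forall k, 0 < alpha k)
  (halpha_sum : series alpha @ \oo --> +oo)
  (halpha_sum2 : cvgn (series (fun k => alpha k ^+ 2)))
  (halpha_le : forall k, alpha k <= 1 / (4 * (L + mu)))
  (* (g) *)
  (hq : q = beta * (2 - beta) / (c * Mg ^+ 2))
  (hzeta : forall k, zeta k = q / (1 - q) * (1 - alpha k * mu))
  (* the solution *)
  (hxs : VI_solution (block_prod (feasible_set g Y)) F xs) :
  (* (i) *)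
  [/\ forall k w, block_prod Y (v k.+1 w) /\ block_prod Y (x k w),
      {ae P, forall w, v ^~ w @ \oo --> xs},
      {ae P, forall w, x ^~ w @ \oo --> xs},
      ('E_P[(fun w => enorm (v k w - xs))%R])%E @[k --> \oo] --> 0%E
    & ('E_P[(fun w => enorm (x k w - xs))%R])%E @[k --> \oo] --> 0%E] /\
  (* (ii) *)
  {ae P, forall w,
     dist (x k w) (block_prod (feasible_set g Y)) @[k --> \oo] --> (0 : R)} /\
  ('E_P[(fun w => dist (x k w) (block_prod (feasible_set g Y)))%R])%E @[k --> \oo] -->
    0%E.
Proof.
have hx0E' j : (\int[P]_w (enorm (submxrow (x 0%N w) j) ^+ 2)%:E < +oo)%E.
  by have := hx0E j; rewrite unlock.
exact: (run_convergence hbeta hN hg_meas homega hd hx0 hx0E' hrun hYclosed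
  hYconvex hS hgconvex hMg hsubgrad hL hF_lip hmu hF_mono hc hsampling
  halpha_gt0 halpha_sum halpha_sum2 halpha_le hxs).
Qed.
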